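(* Let $\mathfrak{S}$ be an equicontractive RIFS of finite type with contraction ratio $r$, and let $A_1,\dots,A_m$ be the adjacency matrices of its essential class. For almost all $\omega\in\Omega$, the box-counting dimension and the Hausdorff dimension of $K_\omega$ are equal to $$\lim_{n\to\infty}\frac{\log\|A_{\omega_1}\cdots A_{\omega_n}\|}{n|\log r|}.$$
   Context: Setting. Let $m\ge1$, $\mathcal{A}=\{1,\dots,m\}$, $\Omega=\mathcal{A}^{\mathbb{N}}$, with the Bernoulli product probability measure $\mathbb{P}$ giving weight $\theta_j>0$ to letter $j$, $\sum_j\theta_j=1$; ''almost all'' refers to $\mathbb{P}$. For each $j\in\mathcal{A}$ let $\mathfrak{S}_j=\{S_{j,k}:k\in\mathcal{I}_j\}$, $\mathcal{I}_j=\{0,\dots,\mathcal{N}(j)\}$, with $S_{j,k}(x)=rx+d_{j,k}$ on $\mathbb{R}$ and one common ratio $0<r<1$; $\mathfrak{S}=\{\mathfrak{S}_1,\dots,\mathfrak{S}_m\}$ is an equicontractive RIFS. With $\mathfrak{S}_j(K)=\bigcup_kS_{j,k}(K)$, the attractor is $K_\omega=\lim_n\mathfrak{S}_{\omega_1}\circ\dots\circ\mathfrak{S}_{\omega_n}(K)$ (Hausdorff metric, any non-empty compact $K$). Standing assumption: the convex hull of $K_\omega$ is $[0,1]$ for every $\omega\in\Omega$. Put $\Lambda_{\omega,n}=\{(\sigma_1,\dots,\sigma_n):\sigma_i\in\mathcal{I}_{\omega_i}\}$ and $S_{\omega,\sigma}=S_{\omega_1,\sigma_1}\circ\dots\circ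 S_{\omega_n,\sigma_n}$. Finite type: there is a finite set $F$ such that for all $n\in\mathbb{N}$, $\omega\in\Omega$, $\sigma,\tau\in\Lambda_{\omega,n}$, either $|S_{\omega,\sigma}(0)-S_{\omega,\tau}(0)|r^{-n}>1$ or $(S_{\omega,\sigma}(0)-S_{\omega,\tau}(0))r^{-n}\in F$. Net intervals: for $n\ge1$ let $h_1<\dots<h_{s_n}$ be the elements of $\{S_{\omega,\sigma}(z):z\in\{0,1\},\sigma\in\Lambda_{\omega,n}\}$; the $\omega$-net intervals of level $n$ are the $[h_i,h_{i+1}]$ with $(h_i,h_{i+1})\cap K_\omega\neq\emptyset$; $[0,1]$ is the only net interval of level $0$. Each net interval $\Delta$ of level $n\ge1$ lies in a unique net interval of level $n-1$, its parent ($\Delta$ is its child). For $\Delta=[a,b]$ of level $n$: normalized length $\ell_n(\Delta)=r^{-n}(b-a)$; neighbour set $V_n^\omega(\Delta)=(a_1,\dots,a_J)$, the increasing list of the distinct numbers $r^{-n}(a-S_{\omega,\sigma}(0))$ over $\sigma\in\Lambda_{\omega,n}$ with $\Delta\subseteq S_{\omega,\sigma}([0,1])$; $t_n(\Delta)=t$ if $\Delta$ is the $t$-th from the left among the children of its parent having the same normalized length and neighbour set as $\Delta$ (and $t_0([0,1])=1$). The characteristic vector of $\Delta$ is $(\ell_n(\Delta),V_n^\omega(\Delta),t_n(\Delta))$; there are only finitely many over all $\omega,n,\Delta$. Paths: for $\nu=(\nu_1,\dots,\nu_k)\in\mathcal{A}^k$, a sequence of characteristic vectors $\gamma=\gamma_0,\dots,\gamma_k=\beta$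 is an admissible $\nu$-path linking $\gamma$ to $\beta$ if there are $\omega\in\Omega$ and $N$ with $\omega_{N+i}=\nu_i$ for $i=1,\dots,k$, and $\omega$-net intervals $\Delta_i$ of level $N+i$ ($i=0,\dots,k$) with characteristic vectors $\gamma_i$ such that each $\Delta_i$ is a child of $\Delta_{i-1}$. An admissible path is an admissible $\nu$-path for some finite word $\nu$; $\beta$ is a child of $\gamma$ if there is an admissible path of length one linking $\gamma$ to $\beta$, and a child under the action of $\mathfrak{S}_k$ if there is an admissible $\nu$-path with $\nu=(k)$ linking $\gamma$ to $\beta$. Essential class: a non-empty set $\mathcal{L}$ of characteristic vectors is a loop class if for all $\gamma,\beta\in\mathcal{L}$ there is an admissible path linking $\gamma$ to $\beta$ with all its vectors in $\mathcal{L}$; it is an essential class if moreover every child of every member of $\mathcal{L}$ is in $\mathcal{L}$. There is exactly one essential class; write it $\mathcal{E}=\{\gamma_1,\dots,\gamma_N\}$. Adjacency matrices: for $k=1,\dots,m$, $A_k$ is the $N\times N$ matrix whose $(i,j)$ entry is $1$ if $\gamma_j$ is a child of $\gamma_i$ under the action of $\mathfrak{S}_k$ and $0$ otherwise. $\|M\|=\sum_{i,j}|M_{ij}|$. *)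

(* Defs.v *)
From HB Require Import structures.
From mathcomp Require Import all_boot all_order all_algebra.
From mathcomp Require Import all_classical all_reals all_analysis.

Set Implicit Arguments.
Unset Strict Implicit.
Unset Printing Implicit Defensive.

Import Order.TTheory GRing.Theory Num.Theory.
Import numFieldNormedType.Exports.

Local Open Scope classical_set_scope.
Local Open Scope ring_scope.

(** * Hausdorff distance, convex hull and dimensions of subsets of the line *)

Section RealSets.
Variable R : realType.
Implicit Types (A B U : set R) (s delta L : R).

Definition infdist (x : R) B : \bar R := ereal_inf [set `|x - y|%:E | y in B].

Definition hausdorff_dist A B : \bar R :=
  maxe (ereal_sup [set infdist x B | x in A])
       (ereal_sup [set infdist y A | y in B]).

Definition conv_hull A : set R :=
  \bigcap_(C in [set C : set R | convex_set (C : set R^o) /\ A `<=` C]) C.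

Definition diam U : \bar R :=
  ereal_sup [set `|p.1 - p.2|%:E | p in U `*` U].

Definition finitely_covered (n : nat) delta A :=
  exists U : 'I_n -> set R,
    (forall i, (diam (U i) <= delta%:E)%E) /\ A `<=` \bigcup_i U i.

(* The default value 0 is taken only if [A] has no finite [delta]-cover. *)
Definition covering_number delta A : nat :=
  xget 0%N [set n | finitely_covered n delta A /\
                    forall k, finitely_covered k delta A -> (n <= k)%N].

Definition has_box_dimension A L :=
  ln (covering_number delta A)%:R / - ln delta @[delta --> 0^'+] --> L.

(* The empty set has weight 0 also for s = 0, where [poweR] would give 1. *)
Definition hausdorff_weight s U : \bar R :=
  if `[< U = set0 >] then 0%E else poweR (diam U) s.

Definition hausdorff_premeasure s delta A : \bar R :=
  ereal_inf [set (\sum_(0 <= i <oo) hausdorff_weight s (U i))%E |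
    U in [set U : nat -> set R |
      (forall i, (diam (U i) <= delta%:E)%E) /\ A `<=` \bigcup_i U i]].

Definition hausdorff_measure s A : \bar R :=
  ereal_sup [set hausdorff_premeasure s delta A | delta in [set d | 0 < d]].

Definition hausdorff_dimension A : \bar R :=
  ereal_inf [set s%:E | s in [set s | 0 <= s /\ hausdorff_measure s A = 0%E]].

End RealSets.

(** * The sequence space and its Bernoulli measures *)

(* The alphabet is ['I_m.+1], so that it has at least one letter. A sequence
   [w : nat -> 'I_m.+1] is indexed from 0: [w i] is the letter of rank i + 1. *)
HB.instance Definition _ (m : nat) := isPointed.Build 'I_m.+1 ord0.

Definition cylinder m n (u : 'I_n -> 'I_m.+1) : set (nat -> 'I_m.+1) :=
  [set w | forall i : 'I_n, w i = u i].

Definition cylinders m : set (set (nat -> 'I_m.+1)) :=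
  [set C | exists n (u : 'I_n -> 'I_m.+1), C = cylinder u].

Definition Omega m := g_sigma_algebraType (@cylinders m).

(* The cylinders are stable under intersection (up to the empty set) and
   generate the sigma-algebra, so this determines [P]. *)
Definition is_bernoulli (R : realType) m (theta : 'I_m.+1 -> R)
    (P : probability (Omega m) R) :=
  forall n (u : 'I_n -> 'I_m.+1),
    P (cylinder u) = (\prod_(i < n) theta (u i))%:E.

(** * Equicontractive random iterated function systems *)

Record rifs (R : realType) (m : nat) := Rifs {
  rifs_ratio : R ;
  rifs_last : 'I_m.+1 -> nat ;
  rifs_shift : forall j : 'I_m.+1, 'I_(rifs_last j).+1 -> R ;
  rifs_ratio_itv : 0 < rifs_ratio < 1
}.

Section Rifs.
Variables (R : realType) (m : nat) (S : rifs R m).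
Local Notation r := (rifs_ratio S).
Implicit Types (w : nat -> 'I_m.+1) (n k : nat) (D : R * R).

Definition simil (j : 'I_m.+1) (k : 'I_(rifs_last S j).+1) (x : R) : R :=
  r * x + rifs_shift k.

Definition ifs_union (j : 'I_m.+1) (K : set R) : set R :=
  \bigcup_(k : 'I_(rifs_last S j).+1) (simil k @` K).

(* As [bigop] is a right fold, this is the composite
   [ifs_union (w 0) \o ... \o ifs_union (w n.-1)]; likewise for [word_map]. *)
Definition ifs_iter w n : set R -> set R :=
  \big[comp/id]_(i < n) ifs_union (w i).

Definition is_attractor w (L : set R) :=
  [/\ L !=set0, compact L &
    forall K : set R, K !=set0 -> compact K ->
      hausdorff_dist (ifs_iter w n K) L @[n --> \oo] --> 0%E].

Definition attractor w : set R := xget set0 (is_attractor w).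

Definition word w n := {dffun forall i : 'I_n, 'I_(rifs_last S (w i)).+1}.

Definition word_map w n (sigma : word w n) : R -> R :=
  \big[comp/id]_(i < n) simil (sigma i).

Definition finite_type :=
  exists2 F : set R, finite_set F &
    forall n w (sigma tau : word w n),
      1 < `|word_map sigma 0 - word_map tau 0| * r ^- n \/
      F ((word_map sigma 0 - word_map tau 0) * r ^- n).

(** ** Net intervals; the interval [a, b] is represented by the pair (a, b) *)

Definition cc D : set R := [set` `[D.1, D.2]].

Definition endpoints w n : seq R :=
  sort <=%R (undup ([seq word_map sigma 0 | sigma : word w n] ++
                    [seq word_map sigma 1 | sigma : word w n])).

Definition net_intervals w n : seq (R * R) :=
  if n is 0 then [:: (0, 1)] else
  [seq D <- zip (endpoints w n) (behead (endpoints w n))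
    | `[< [set` `]D.1, D.2[] `&` attractor w !=set0 >]].

(* [D] has level [n] and [D'] has level [n.+1]. *)
Definition net_child w n D D' :=
  [/\ D \in net_intervals w n, D' \in net_intervals w n.+1 & cc D' `<=` cc D].

Definition norm_length n D : R := r ^- n * (D.2 - D.1).

Definition neighbour_set w n D : seq R :=
  sort <=%R (undup
    [seq r ^- n * (D.1 - word_map sigma 0) | sigma <- enum {: word w n}
       & `[< cc D `<=` word_map sigma @` [set` `[0, 1]] >]]).

Definition siblings w n D : seq (R * R) :=
  [seq D' <- net_intervals w n.+1
    | `[< exists D0, net_child w n D0 D /\ net_child w n D0 D' >]].

Definition sibling_rank w n D : nat :=
  if n is n'.+1 then
    (index D [seq D' <- siblings w n' D
       | (norm_length n D' == norm_length n D)
         && (neighbour_set w n D' == neighbour_set w n D)]).+1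
  else 1%N.

Definition charvec : Type := (R * seq R * nat)%type.

Definition char_vector w n D : charvec :=
  (norm_length n D, neighbour_set w n D, sibling_rank w n D).

Definition char_vectors : set charvec :=
  [set g | exists w n D, D \in net_intervals w n /\ g = char_vector w n D].

(** ** Admissible paths and the essential class *)

Definition admissible_word_path k (nu : 'I_k -> 'I_m.+1)
    (g : 'I_k.+1 -> charvec) :=
  exists w (N : nat) (D : 'I_k.+1 -> R * R),
    [/\ forall i : 'I_k, w (N + i)%N = nu i,
        forall i : 'I_k.+1, D i \in net_intervals w (N + i) /\
                            char_vector w (N + i) (D i) = g i
      & forall i : 'I_k,
          net_child w (N + i) (D (widen_ord (leqnSn k) i)) (D (lift ord0 i))].

Definition admissible_path k (g : 'I_k.+1 -> charvec) :=
  exists nu : 'I_k -> 'I_m.+1, admissible_word_path nu g.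

Definition links k (g : 'I_k.+1 -> charvec) (alpha beta : charvec) :=
  g ord0 = alpha /\ g ord_max = beta.

Definition cv_child (alpha beta : charvec) :=
  exists g : 'I_2 -> charvec, admissible_path g /\ links g alpha beta.

Definition cv_child_under (j : 'I_m.+1) (alpha beta : charvec) :=
  exists g : 'I_2 -> charvec,
    admissible_word_path (fun _ : 'I_1 => j) g /\ links g alpha beta.

Definition loop_class (L : set charvec) :=
  [/\ L !=set0, L `<=` char_vectors &
    forall alpha beta, L alpha -> L beta ->
      exists k (g : 'I_k.+1 -> charvec),
        [/\ (0 < k)%N, admissible_path g, links g alpha beta
          & forall i, L (g i)]].

Definition essential_class (L : set charvec) :=
  loop_class L /\ forall alpha beta, L alpha -> cv_child alpha beta -> L beta.

Definition adjacency N (gamma : 'I_N -> charvec) (j : 'I_m.+1) : 'M[R]_N :=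
  \matrix_(i, i') (`[< cv_child_under j (gamma i) (gamma i') >])%:R.

End Rifs.

Definition mx_sum_norm (R : realType) N (M : 'M[R]_N) : R :=
  \sum_i \sum_j `|M i j|.

(* Main.v *)
Require Import Defs.
From HB Require Import structures.
From mathcomp Require Import all_boot all_order all_algebra finmap.
From mathcomp Require Import all_classical all_reals all_analysis.
From mathcomp Require Import ring lra.

Set Implicit Arguments.
Unset Strict Implicit.
Unset Printing Implicit Defensive.

Import Order.TTheory GRing.Theory Num.Theory.
Import numFieldNormedType.Exports.

Local Open Scope classical_set_scope.
Local Open Scope ring_scope.

(** ** Idea of the proof

Everything is compared with one quantity. For a finite word u let M(u), below
[npts u], be the number of distinct points S_(u,sigma)(0), where sigma runs over
the addresses of u, and let M_n(w) be its value at the first n letters of w.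

- By finite type, distinct points of level n are at distance at least c r^n
  ([finite_type_separated]). As
  S_(uv,sigma tau)(0) = S_(u,sigma)(0) + r^|u| S_(v,tau)(0), this gives
  M(uv) <= M(u) M(v) <= C M(uv) with a constant C that depends on no word
  ([npts_cat_le], [npts_cat_ge]). So log M is additive up to a constant.
- An almost additive function of a Bernoulli sequence has a rate of growth
  almost surely ([almost_additive_ae_cvg]). For blocks of length k the
  exponential moments of log M and of log C - log M are submultiplicative, so
  that Chernoff's bound and the Borel-Cantelli lemma confine log M_n / n, for n
  large, to an interval of length O(1/k); let k grow.
- Given the limit of log M_n(w) / n, both dimensions of the attractor are
  computed for that w. The M_n intervals [y, y + r^n] cover it, and their left
  end points are separated points of the attractor; hence the box dimension
  ([box_dimension]) and the upper bound for the Hausdorff dimension. For the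
  lower bound, a ball of radius comparable to r^k contains at most C M_n / M_k
  of the points of level n ([npts_ball]); a finite cover is compared with the
  points of a sufficiently deep level, which replaces a Frostman measure
  ([hausdorff_premeasure_gt0]).
- For every w, and not only almost surely, the norm of the product of the
  adjacency matrices along w is comparable with M_n(w). The difficulty is that
  an interval between consecutive end points is a net interval only if it meets
  the attractor, which depends on the letters still to come. But whether it does
  depends on the past only through its length and neighbour set ([liveP]), and
  so does the rank of a child among its siblings ([sibling_rank_transfer]).
  A path of characteristic vectors is therefore realised, step by step, below
  any interval of the right type, and distinct paths give distinct intervals,
  whose number is at most a constant times M_n(w) ([rowsum_le_count],
  [norm_le_npts]). Conversely, choose a basic interval inside the interior of an
  essential net interval and let w follow it: the M_n(w) points inside are left
  end points of net intervals, each reached by a path, since an essential class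
  contains the children of its members ([count_le_rowsum], [npts_le_norm]).
*)

(** * Prefixes and tails of letter sequences *)

Section Words.
Variable T : Type.
Implicit Types (w : nat -> T) (u : seq T) (n k : nat).

Definition pfx w n : seq T := mkseq w n.
Definition tail n w : nat -> T := fun i => w (n + i)%N.
(** Past the end of [u] the default value takes over, which is a letter of [w]. *)
Definition catw u w : nat -> T := fun i => nth (w (i - size u)%N) u i.

Lemma size_pfx w n : size (pfx w n) = n.
Proof. exact: size_mkseq. Qed.

Lemma tail_tail n k w : tail n (tail k w) = tail (k + n) w.
Proof. by apply/funext => i; rewrite /tail addnA. Qed.

Lemma pfxS w n : pfx w n.+1 = w 0%N :: pfx (tail 1 w) n.
Proof.
by rewrite /pfx /mkseq /= (iotaDl 1 0) -map_comp.
Qed.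

Lemma pfx_rcons w n : pfx w n.+1 = rcons (pfx w n) (w n).
Proof. exact: mkseqS. Qed.

Lemma pfxD w n k : pfx w (n + k) = pfx w n ++ pfx (tail n w) k.
Proof.
by rewrite /pfx /mkseq iotaD map_cat add0n -{2}[n]addn0 iotaDl -map_comp.
Qed.

Lemma catw_pfx_tail w n : catw (pfx w n) (tail n w) = w.
Proof.
apply/funext => i; rewrite /catw size_pfx /tail.
case: (ltnP i n) => lin; first by rewrite nth_mkseq.
by rewrite nth_default ?size_pfx // subnKC.
Qed.

Lemma pfx_catw u w n : pfx (catw u w) (size u + n) = u ++ pfx w n.
Proof.
rewrite pfxD; congr (_ ++ _).
  case: u => [//|x0 u]; apply: (@eq_from_nth _ x0); rewrite size_pfx // => i li.
  by rewrite nth_mkseq // /catw (set_nth_default x0).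
apply: (@eq_from_nth _ (w 0%N)); rewrite !size_pfx // => i li.
rewrite !nth_mkseq // /tail /catw nth_default ?leq_addr //.
by rewrite addKn.
Qed.

Lemma pfx_catw_size u w : pfx (catw u w) (size u) = u.
Proof. by rewrite -[size u]addn0 pfx_catw cats0. Qed.

Lemma tail_catw u w n : tail (size u + n) (catw u w) = tail n w.
Proof.
apply/funext => i.
by rewrite /tail /catw nth_default -addnA ?leq_addr // addKn.
Qed.

Lemma tail_catw_size u w : tail (size u) (catw u w) = w.
Proof. by rewrite -[size u]addn0 tail_catw. Qed.

Lemma catw_cat u v w : catw (u ++ v) w = catw u (catw v w).
Proof.
rewrite -[RHS](catw_pfx_tail _ (size u + size v)) pfx_catw pfx_catw_size.
by rewrite tail_catw tail_catw_size.
Qed.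

End Words.

(** * The points of a level and the attractor *)

Section Points.
Variables (R : realType) (m : nat) (S : rifs R m).
Local Notation r := (rifs_ratio S).
Local Notation letter := 'I_m.+1.
Implicit Types (u v : seq letter) (w : nat -> letter) (x y z : R).

Lemma ratio_gt0 : 0 < r. Proof. by case/andP: (rifs_ratio_itv S). Qed.
Lemma ratio_lt1 : r < 1. Proof. by case/andP: (rifs_ratio_itv S). Qed.
Hint Resolve ratio_gt0 ratio_lt1 : core.

Lemma ratioX_gt0 n : 0 < r ^+ n. Proof. exact: exprn_gt0. Qed.
Lemma ratioX_neq0 n : r ^+ n != 0. Proof. exact/lt0r_neq0/ratioX_gt0. Qed.
Lemma ratioX_le1 n : r ^+ n <= 1. Proof. by rewrite exprn_ile1 ?ltW. Qed.
Hint Resolve ratioX_gt0 ratioX_neq0 : core.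

Lemma ratioX_small (e : R) : 0 < e -> exists n, r ^+ n < e.
Proof.
move=> e0; have : `|r| < 1 by rewrite ger0_norm ?ltW.
move=> /cvg_expr /(cvgr0_norm_lt _) /(_ e e0) [k _ /(_ k (leqnn k)) /=].
by rewrite ger0_norm ?ltW // => ?; exists k.
Qed.

Definition digits (j : letter) : seq R :=
  [seq rifs_shift k | k : 'I_(rifs_last S j).+1].

(** Several addresses may give the same point, and it must be counted once. *)
Fixpoint pts u : seq R :=
  if u is j :: v then undup [seq d + r * x | d <- digits j, x <- pts v]
  else [:: 0].

Lemma digitsP j d : reflect (exists k : 'I_(rifs_last S j).+1, d = rifs_shift k)
  (d \in digits j).
Proof.
apply: (iffP idP) => [/mapP[k _ ->]|[k ->]]; first by exists k.
by apply/mapP; exists k; rewrite ?mem_enum.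
Qed.

Lemma pts_uniq u : uniq (pts u).
Proof. by case: u => //= *; exact: undup_uniq. Qed.

Lemma mem_pts_nil x : (x \in pts [::]) = (x == 0).
Proof. by rewrite inE. Qed.

Lemma mem_pts_cons j v x : x \in pts (j :: v) <->
  exists d y, [/\ d \in digits j, y \in pts v & x = d + r * y].
Proof.
rewrite mem_undup; split => [/allpairsP[[d y] /= [? ? ->]]|[d [y [? ? ->]]]].
  by exists d, y.
by apply/allpairsP; exists (d, y).
Qed.

Lemma mem_pts_cat u v x : x \in pts (u ++ v) <->
  exists y z, [/\ y \in pts u, z \in pts v & x = y + r ^+ size u * z].
Proof.
elim: u x => [|j u IH] x /=.
  split=> [xv|[y [z []]]]; last by rewrite mem_pts_nil => /eqP-> ? ->; rewrite mul1r add0r.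
  by exists 0, x; rewrite mem_pts_nil mul1r add0r; split.
split.
  move=> /mem_pts_cons[d [x' [dj /IH[y [z [yu zv ->]]] ->]]].
  exists (d + r * y), z; split => //; last by rewrite exprS; ring.
  by apply/mem_pts_cons; exists d, y.
move=> [y [z [/mem_pts_cons[d [y' [dj yu ->]]] zv ->]]].
apply/mem_pts_cons; exists d, (y' + r ^+ size u * z); split => //.
  by apply/IH; exists y', z.
by rewrite exprS; ring.
Qed.

Lemma mem_pts_rcons u j x : x \in pts (rcons u j) <->
  exists y d, [/\ y \in pts u, d \in digits j & x = y + r ^+ size u * d].
Proof.
rewrite -cats1; split.
  move=> /mem_pts_cat[y [z [yu /mem_pts_cons[d [y0 [dj]]]]]].
  by rewrite mem_pts_nil => /eqP-> -> ->; exists y, d; rewrite mulr0 addr0; split.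
move=> [y [d [yu dj ->]]]; apply/mem_pts_cat; exists y, d; split => //.
by apply/mem_pts_cons; exists d, 0; rewrite mem_pts_nil mulr0 addr0.
Qed.

(** The attractor is the limit of the images of any compact set; those of {0}
are finite and known. *)
Lemma mem_ifs_iter w n x :
  ifs_iter S w n [set 0] x <-> x \in pts (pfx w n).
Proof.
elim: n w x => [|n IH] w x.
  by rewrite /ifs_iter big_ord0 mem_pts_nil; split => [->//|/eqP].
rewrite pfxS mem_pts_cons /ifs_iter big_ord_recl /= -/(ifs_iter S (tail 1 w) n).
split.
  move=> [k _ [y /IH yv <-]]; exists (rifs_shift k), y; split => //.
    by apply/digitsP; exists k.
  by rewrite /simil addrC.
move=> [d [y [/digitsP[k ->] /IH yv ->]]]; exists k => //; exists y => //.
by rewrite /simil addrC.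
Qed.

Lemma word_mapE w n (sigma : word S w n) x :
  word_map sigma x = \sum_(i < n) r ^+ i * rifs_shift (sigma i) + r ^+ n * x.
Proof.
rewrite /word_map.
have gen (h : forall i : 'I_n, 'I_(rifs_last S (w i)).+1) :
  (\big[comp/id]_(i < n) simil (h i)) x =
    \sum_(i < n) r ^+ i * rifs_shift (h i) + r ^+ n * x; last exact: (gen sigma).
clear sigma.
elim: n w h => [|n IH] w h; first by rewrite !big_ord0 add0r mul1r.
rewrite !big_ord_recl /= (IH (tail 1 w) (fun i => h (lift ord0 i))).
rewrite /simil mulrDr mulr_sumr exprS mul1r mulrA [LHS]addrC addrA.
congr (_ + _ + _).
by apply: eq_bigr => i _; rewrite mulrA -exprS.
Qed.

Lemma word_mapD w n (sigma : word S w n) x :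
  word_map sigma x = word_map sigma 0 + r ^+ n * x.
Proof. by rewrite !word_mapE mulr0 addr0. Qed.

Lemma word_map0P w n x :
  (exists sigma : word S w n, word_map sigma 0 = x) <-> x \in pts (pfx w n).
Proof.
transitivity (exists h : forall i : 'I_n, 'I_(rifs_last S (w i)).+1,
    \sum_(i < n) r ^+ i * rifs_shift (h i) = x).
  split=> [[s <-]|[h <-]].
    by exists s; rewrite word_mapE mulr0 addr0.
  exists [ffun i => h i]; rewrite word_mapE mulr0 addr0.
  by apply: eq_bigr => i _; rewrite ffunE.
elim: n w x => [|n IH] w x.
  rewrite mem_pts_nil; split=> [[h]|/eqP->]; first by rewrite big_ord0 => <-.
  by exists (fun i => ord0); rewrite big_ord0.
rewrite pfxS mem_pts_cons; split.
  move=> [h <-]; rewrite big_ord_recl /= mul1r.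
  exists (rifs_shift (h ord0)), (\sum_(i < n) r ^+ i * rifs_shift (h (lift ord0 i))).
  split; first by apply/digitsP; exists (h ord0).
    by apply/(IH (tail 1 w)); exists (fun i => h (lift ord0 i)).
  congr (_ + _); rewrite mulr_sumr; apply: eq_bigr => i _.
  by rewrite mulrA -exprS.
move=> [d [y [/digitsP[k ->] /(IH (tail 1 w))[h <-] ->]]].
pose shift_at (i : 'I_n.+1) :=
  if unlift ord0 i is Some j then rifs_shift (h j) else rifs_shift k.
have [g gE] : exists g : forall i : 'I_n.+1, 'I_(rifs_last S (w i)).+1,
    forall i, rifs_shift (g i) = shift_at i.
  apply: (@fin_all_exists _ (fun i : 'I_n.+1 => 'I_(rifs_last S (w i)).+1)
    (fun i g => rifs_shift g = shift_at i)) => i; rewrite /shift_at.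
  case: unliftP => [j ->|->]; [by exists (h j)|by exists k].
exists g; rewrite big_ord_recl mul1r gE /shift_at unlift_none; congr (_ + _).
rewrite mulr_sumr; apply: eq_bigr => i _.
by rewrite gE /shift_at liftK mulrA -exprS.
Qed.

End Points.

Section Attractor.
Variables (R : realType) (m : nat) (S : rifs R m).
Local Notation r := (rifs_ratio S).
Local Notation letter := 'I_m.+1.
Implicit Types (u v : seq letter) (w : nat -> letter) (x y z : R).

Let r_gt0 : 0 < r. Proof. exact: ratio_gt0. Qed.
Let r_lt1 : r < 1. Proof. exact: ratio_lt1. Qed.
Let rX_gt0 n : 0 < r ^+ n. Proof. exact: ratioX_gt0. Qed.
Hint Resolve r_gt0 r_lt1 rX_gt0 : core.

Lemma conv_hull_sub (A : set R) : A `<=` conv_hull A.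
Proof. by move=> x Ax C [_]; apply. Qed.

Lemma conv_hull_itv (A : set R) a b :
  A `<=` [set` `[a, b]] -> conv_hull A `<=` [set` `[a, b]].
Proof.
move=> Aab x; apply; split => // y z l; rewrite !inE /= !in_itv /= => yab zab.
have l0 : 0 <= l%:num by [].
have l1 : l%:num <= 1 by [].
suff : a <= l%:num * y + (1 - l%:num) * z <= b by [].
move: (l%:num) l0 l1 => t t0 t1; nra.
Qed.

Lemma hausdorff_distP (A B : set R) (e : R) : (hausdorff_dist A B < e%:E)%E ->
  (forall x, A x -> exists2 y, B y & `|x - y| < e) /\
  (forall y, B y -> exists2 x, A x & `|x - y| < e).
Proof.
rewrite /hausdorff_dist gt_max => /andP[h1 h2].
have aux C D z : C z -> (ereal_sup [set infdist x D | x in C] < e%:E)%E ->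
    exists2 y, D y & `|z - y| < e.
  move=> Cz Ce; have : (infdist z D < e%:E)%E.
    by apply: le_lt_trans Ce; apply: ereal_sup_ubound; exists z.
  by move=> /ereal_inf_lt[_ [y Dy <-]]; rewrite lte_fin; exists y.
split=> [x Ax|y By]; first exact: aux h1.
by have [x Ax xy] := aux _ _ _ By h2; exists x => //; rewrite distrC.
Qed.

Lemma closed_approx (K : set R) x : closed K ->
  (forall e : R, 0 < e -> exists2 y, K y & `|x - y| < e) -> K x.
Proof.
move=> cK h; rewrite (closure_id K).1 // => B /nbhs_ballP[e /= e0 eB].
by have [y Ky xy] := h _ e0; exists y; split => //; exact: eB.
Qed.

Section Hull.
Hypothesis hull : forall w, conv_hull (attractor S w) = [set` `[0, 1]].

(** The default value of [attractor] is the empty set, whose hull is not [0, 1]. *)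
Lemma attractorP w : is_attractor S w (attractor S w).
Proof.
rewrite /attractor; case: xgetP => [L -> //|none].
have := hull w; rewrite /attractor xgetPN // => hE.
have : [set` `[0 : R, 1]] 0 by rewrite /= in_itv /= lexx ler01.
rewrite -hE => /(@conv_hull_itv set0 2 3 (@sub0set _ _)).
by rewrite /= in_itv /= => /andP[h _]; move: h; rewrite lt_geF.
Qed.

Lemma attractor_itv w x : attractor S w x -> 0 <= x <= 1.
Proof.
by move=> /(@conv_hull_sub (attractor S w)); rewrite hull /= in_itv.
Qed.

Lemma attractor_closed w : closed (attractor S w).
Proof.
by have [_ c _] := attractorP w; apply: compact_closed => //; exact: Rhausdorff.
Qed.

(** A compact set contains the two ends of its convex hull. *)
Lemma attractor_min_max w : attractor S w 0 /\ attractor S w 1.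
Proof.
have [n0 cK _] := attractorP w.
have cid : {within attractor S w, continuous (id : R -> R)}.
  by apply: continuous_subspaceT => x; exact: cvg_id.
have [c] := compact_EVT_min n0 cK cid.
have [c'] := compact_EVT_max n0 cK cid.
rewrite !inE => Kc' maxc' Kc minc.
have sub : attractor S w `<=` [set` `[c, c']].
  by move=> t Kt /=; rewrite in_itv /= minc ?maxc' ?inE.
have := conv_hull_itv sub; rewrite hull => sub'.
have /sub' : [set` `[0 : R, 1]] 0 by rewrite /= in_itv /= lexx ler01.
have /sub' : [set` `[0 : R, 1]] 1 by rewrite /= in_itv /= lexx ler01.
rewrite /= !in_itv /= => /andP[_ c1] /andP[c0 _].
have /andP[c0' _] := attractor_itv Kc; have /andP[_ c1'] := attractor_itv Kc'.
by split; [rewrite (_ : 0 = c) //|rewrite (_ : 1 = c') //]; lra.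
Qed.

Lemma attractor_near w e : 0 < e -> exists n0, forall n, (n0 <= n)%N ->
  (forall x, x \in pts S (pfx w n) -> exists2 y, attractor S w y & `|x - y| < e) /\
  (forall y, attractor S w y -> exists2 x, x \in pts S (pfx w n) & `|x - y| < e).
Proof.
move=> e0; have [_ _ lim] := attractorP w.
have := lim [set 0] (ex_intro _ 0 erefl) (@finite_compact _ _ (finite_set1 0)).
move=> /(_ [set y | (y < e%:E)%E]) /=.
case; first exact: (@nbhs_open_ereal_lt _ 0 (fun=> e)).
move=> n0 _ h; exists n0 => n n0n.
have [h1 h2] := hausdorff_distP (h n n0n).
split=> [x xp|y Ky]; first by apply: h1; apply/mem_ifs_iter.
by have [x /mem_ifs_iter xp xy] := h2 _ Ky; exists x.
Qed.

(** At finite levels this is [mem_pts_cons]. It passes to the limit because the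
attractor of the remaining letters is closed and there are finitely many
digits. *)
Lemma attractor_step w x : attractor S w x <->
  exists d z, [/\ d \in digits S (w 0%N), attractor S (tail 1 w) z & x = d + r * z].
Proof.
split; last first.
  move=> [d [z [dj Kz ->]]]; apply: closed_approx; first exact: attractor_closed.
  move=> e e0; have e20 : 0 < e / 2 by lra.
  have [n1 h1] := attractor_near (tail 1 w) e20.
  have [n2 h2] := attractor_near w e20.
  have [_ /(_ _ Kz)[y yp yz]] := h1 (maxn n1 n2) (leq_maxl _ _).
  have [/(_ (d + r * y)) [|t Kt ty _]] := h2 (maxn n1 n2).+1 (leqW (leq_maxr _ _)).
    by rewrite pfxS; apply/mem_pts_cons; exists d, y.
  exists t => //; have r1 := r_lt1; have r0 := r_gt0.
  move: yz ty; rewrite !ltr_distl => /andP[? ?] /andP[? ?]; apply/andP; split; nra.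
move=> Kx; apply: contrapT => no.
(* As no digit works, closedness gives each of them a gap; take the least. *)
have [e e0 he] : exists2 e, 0 < e & forall d z, d \in digits S (w 0%N) ->
    attractor S (tail 1 w) z -> e <= `|x - (d + r * z)|.
  have : forall d, d \in digits S (w 0%N) -> exists2 e, 0 < e & forall z,
      attractor S (tail 1 w) z -> e <= `|x - (d + r * z)|.
    move=> d dj; apply: contrapT => h; apply: no.
    exists d, ((x - d) / r); split => //; last by rewrite mulrCA mulfV ?lt0r_neq0 //; lra.
    apply: closed_approx; first exact: attractor_closed.
    move=> e e0; apply: contrapT => h'; apply: h; exists (r * e); first exact: mulr_gt0.
    move=> z Kz; rewrite leNgt; apply/negP => lt; apply: h'; exists z => //.
    rewrite -(ltr_pM2l r_gt0) -{1}(ger0_norm (ltW r_gt0)) -normrM.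
    rewrite (_ : r * ((x - d) / r - z) = x - (d + r * z)); first exact: lt.
    by field; exact: lt0r_neq0.
  elim: (digits S (w 0%N)) => [|d s IH] h; first by exists 1.
  have [e1 e10 h1] := h d (mem_head _ _).
  have [|e2 e20 h2] := IH; first by move=> d' d's; apply: h; rewrite inE d's orbT.
  exists (Num.min e1 e2); first by rewrite lt_min e10.
  move=> d' z; rewrite inE => /orP[/eqP-> Kz|d's Kz]; rewrite ge_min ?h1 //.
  by rewrite h2 ?orbT.
have e20 : 0 < e / 2 by lra.
have [n1 h1] := attractor_near (tail 1 w) e20.
have [n2 h2] := attractor_near w e20.
have [_ /(_ _ Kx)[y + yx]] := h2 (maxn n1 n2).+1 (leqW (leq_maxr _ _)).
rewrite pfxS => /mem_pts_cons[d [t [dj tp yE]]].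
have [/(_ _ tp)[z Kz zt] _] := h1 (maxn n1 n2) (leq_maxl _ _).
have := he _ _ dj Kz; rewrite leNgt => /negP; apply.
have r1 := r_lt1; have r0 := r_gt0; move: zt yx; rewrite yE.
rewrite !ltr_distl => /andP[? ?] /andP[? ?]; apply/andP; split; nra.
Qed.

Lemma attractor_cat u w x : attractor S (catw u w) x <->
  exists y z, [/\ y \in pts S u, attractor S w z & x = y + r ^+ size u * z].
Proof.
elim: u x => [|j u IH] x.
  rewrite (_ : catw [::] w = w); last first.
    by apply/funext => i; rewrite /catw nth_nil subn0.
  split=> [Kx|[y [z [/[!mem_pts_nil]/eqP-> Kz ->]]]]; last by rewrite mul1r add0r.
  by exists 0, x; rewrite mem_pts_nil mul1r add0r.
rewrite attractor_step -cat1s catw_cat (@tail_catw_size _ [:: j]).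
have -> : catw [:: j] (catw u w) 0 = j by [].
split.
  move=> [d [x' [dj /IH[y [z [yu Kz ->]] ->]]]].
  exists (d + r * y), z; split => //; last by rewrite exprS; ring.
  by apply/mem_pts_cons; exists d, y.
move=> [y [z [/mem_pts_cons[d [y' [dj yu ->]]] Kz ->]]].
exists d, (y' + r ^+ size u * z); split => //; last by rewrite exprS; ring.
by apply/IH; exists y', z.
Qed.

Lemma digits_itv j d : d \in digits S j -> 0 <= d <= 1 - r.
Proof.
move=> dj; pose w := fun _ : nat => j.
have [K0 K1] := attractor_min_max (tail 1 w).
have /attractor_itv : attractor S w d.
  by apply/attractor_step; exists d, 0; rewrite mulr0 addr0.
have /attractor_itv : attractor S w (d + r).
  by apply/attractor_step; exists d, 1; rewrite mulr1.
by lra.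
Qed.

(** The end points 0 and 1 of the attractor must come from maps that fix them;
this makes the end points of one level end points of all later levels. *)
Lemma digits_min j : 0 \in digits S j.
Proof.
have [K0 _] := attractor_min_max (fun _ : nat => j).
have [d [z [dj Kz]]] := (attractor_step _ _).1 K0.
have /andP[? _] := digits_itv dj; have /andP[? _] := attractor_itv Kz.
have r0 := r_gt0; move=> e; rewrite (_ : 0 = d) //; nra.
Qed.

Lemma digits_max j : 1 - r \in digits S j.
Proof.
have [_ K1] := attractor_min_max (fun _ : nat => j).
have [d [z [dj Kz]]] := (attractor_step _ _).1 K1.
have /andP[_ ?] := digits_itv dj; have /andP[_ ?] := attractor_itv Kz.
have r0 := r_gt0; move=> e; rewrite (_ : 1 - r = d) //; nra.
Qed.

Lemma pts_itv u x : x \in pts S u -> 0 <= x <= 1 - r ^+ size u.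
Proof.
elim: u x => [|j u IH] x; first by rewrite mem_pts_nil => /eqP->; rewrite expr0; lra.
rewrite [size _]/=.
move=> /mem_pts_cons[d [y [/digits_itv/andP[d0 d1] /IH/andP[y0 y1] ->]]].
rewrite exprS; have r0 := r_gt0; apply/andP; split; nra.
Qed.

Lemma pts_min u : 0 \in pts S u.
Proof.
elim: u => [|j u IH]; first by rewrite mem_pts_nil.
by apply/mem_pts_cons; exists 0, 0; rewrite mulr0 addr0 digits_min.
Qed.

Lemma pts_max u : 1 - r ^+ size u \in pts S u.
Proof.
elim: u => [|j u IH]; first by rewrite mem_pts_nil expr0 subrr.
apply/mem_pts_cons; exists (1 - r), (1 - r ^+ size u).
by split; rewrite ?digits_max // exprS; ring.
Qed.

Lemma pts_attractor u w x : x \in pts S u -> attractor S (catw u w) x.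
Proof.
move=> xu; apply/attractor_cat; exists x, 0; rewrite mulr0 addr0; split => //.
by have [] := attractor_min_max w.
Qed.

End Hull.

(** The normalized differences of absolute value at most 1 form a finite set, so
the nonzero ones are bounded away from 0. *)
Lemma finite_type_separated : finite_type S -> exists2 c : R, 0 < c <= 1 &
  forall u x y, x \in pts S u -> y \in pts S u -> x != y ->
    c * r ^+ size u <= `|x - y|.
Proof.
move=> [F finF hF].
have [c /andP[c0 c1] cF] : exists2 c : R, 0 < c <= 1 &
    forall f, F f -> f != 0 -> c <= `|f|.
  move: finF => /finite_seqP[s ->]; elim: s => [|f s [c /andP[c0 c1] IH]].
    by exists 1; rewrite ?ltr01 ?lexx // => f; rewrite /= in_nil.
  have [->|f0] := eqVneq f 0.
    exists c; rewrite ?c0 // => g; rewrite /= inE => /orP[/eqP->|]; last exact: IH.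
    by rewrite eqxx.
  exists (Num.min c `|f|); first by rewrite lt_min c0 normr_gt0 f0 ge_min c1.
  move=> g; rewrite /= inE => /orP[/eqP-> _|gs g0]; rewrite ge_min ?lexx ?orbT //.
  by rewrite IH.
exists c; rewrite ?c0 // => u x y xu yu xy.
pose w : nat -> letter := catw u (fun=> ord0).
move: xu yu; rewrite -{1 2}(pfx_catw_size u (fun=> ord0)) -/w.
move=> /word_map0P[sx sxE] /word_map0P[sy syE].
have := hF _ _ sx sy; rewrite sxE syE => -[].
  rewrite ltr_pdivlMr ?rX_gt0 // mul1r => h; apply: le_trans (ltW h).
  by rewrite ler_piMl // ltW.
move=> /cF; rewrite mulf_eq0 subr_eq0 (negbTE xy) invr_eq0 (negbTE (lt0r_neq0 (rX_gt0 _))).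
move=> /(_ isT); rewrite normrM normfV (ger0_norm (ltW (rX_gt0 _))).
by rewrite ler_pdivlMr ?rX_gt0.
Qed.

End Attractor.

(** * Counting arguments *)

Section Counting.

Lemma size_le_fibres (T U : eqType) (f : T -> U) (s : seq T) (t : seq U) K :
  (forall z, z \in t -> size [seq x <- s | f x == z] <= K)%N ->
  {in s, forall x, f x \in t} -> (size s <= K * size t)%N.
Proof.
move=> fK st.
suff : (count (fun x => f x \in t) s <= K * size t)%N.
  suff /eqP <- : count (fun x => f x \in t) s == size s by [].
  by rewrite -all_count; apply/allP.
elim: t {st} fK => [|z t IH] fK; first by rewrite (@eq_count _ _ pred0) ?count_pred0.
rewrite (@eq_count _ _ (predU (fun x => f x == z) (fun x => f x \in t))); last first.
  by move=> x; rewrite /= inE.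
rewrite mulnS; apply: leq_trans (_ : count (fun x => f x == z) s +
  count (fun x => f x \in t) s <= _)%N.
  by rewrite -count_predUI leq_addr.
rewrite leq_add ?IH //; last by move=> y yt; rewrite fK // inE yt orbT.
by rewrite -size_filter fK // mem_head.
Qed.

Lemma size_le_sum_count (T : eqType) (t : seq T) (Q : nat -> pred T) n :
  {in t, forall p, exists2 i, (i < n)%N & Q i p} ->
  (size t <= \sum_(i < n) size [seq p <- t | Q i p])%N.
Proof.
elim: t => [//|p t IH] h.
have [|i il Qi] := h p; first exact: mem_head.
rewrite (bigD1 (Ordinal il)) //= Qi /= addSn ltnS.
apply: leq_trans (IH _) _; first by move=> q qt; apply: h; rewrite inE qt orbT.
rewrite (bigD1 (Ordinal il)) //= leq_add2l; apply: leq_sum => j _.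
by case: (Q j p) => //=.
Qed.

Lemma sum_count_le (T : eqType) (I : finType) (L : seq T) (P : pred I)
    (a : I -> pred T) (b : pred T) :
  (forall i q, P i -> a i q -> b q) ->
  (forall q i i', q \in L -> P i -> P i' -> a i q -> a i' q -> i = i') ->
  (\sum_(i | P i) count (a i) L <= count b L)%N.
Proof.
move=> ab; elim: L => [|q L IH] inj /=; first by rewrite big1.
rewrite big_split /= leq_add ?IH //; last first.
  by move=> q' i i' q'L; apply: inj; rewrite in_cons q'L orbT.
have [[i Pi ai]|no] := pselect (exists2 i, P i & a i q); last first.
  by rewrite big1 // => i Pi; case ai : (a i q) => //; case: no; exists i.
rewrite (bigD1 i) //= big1 ?addn0 ?ai ?(ab i) // => i' /andP[Pi' ii'].
case ai' : (a i' q) => //; case/eqP: ii'.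
by apply: (inj q) => //; exact: mem_head.
Qed.

Lemma count_le_sum (T U : eqType) (L : seq T) (J : seq U) (a : U -> pred T) (b : pred T) :
  (forall q, q \in L -> b q -> exists2 j, j \in J & a j q) ->
  (count b L <= \sum_(j <- J) count (a j) L)%N.
Proof.
elim: L => [|q L IH] h /=; first by rewrite big1_seq.
rewrite big_split /= leq_add ?IH //; 
  last by move=> q' q'L; apply: h; rewrite in_cons q'L orbT.
case bq : (b q) => //; have [j jJ aj] := h q (mem_head _ _) bq.
by rewrite (big_rem j) //= aj.
Qed.

(** The integer part of (x - a) / d tells the elements apart. *)
Lemma size_separated (R : realType) (s : seq R) (a d t : R) : 0 < d -> uniq s ->
  {in s &, forall x y, x != y -> d <= `|x - y|} ->
  {in s, forall x, a <= x <= a + t * d} -> (size s <= (Num.truncn t).+1)%N.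
Proof.
move=> d0 us sep itv; pose f (x : R) := Num.truncn ((x - a) / d).
have fE x : x \in s -> (f x)%:R * d <= x - a < (f x).+1%:R * d.
  move=> /itv/andP[ax _]; rewrite -ler_pdivlMr // -ltr_pdivrMr //.
  by apply: truncn_itv; apply: divr_ge0; [rewrite subr_ge0|exact: ltW].
rewrite -(size_map f) -(size_iota 0 (Num.truncn t).+1); apply: uniq_leq_size.
  rewrite map_inj_in_uniq // => x y xs ys fxy; apply: contrapT => /eqP xy.
  have := fE x xs; have := fE y ys; have := sep _ _ xs ys xy; rewrite fxy.
  rewrite -natr1 => h /andP[? ?] /andP[? ?].
  move: h; apply/negP; rewrite -ltNge ltr_norml; apply/andP; split; lra.
move=> _ /mapP[x xs ->]; rewrite mem_iota add0n ltnS; apply: le_truncn.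
by rewrite ler_pdivrMr //; have /andP[_ ?] := itv x xs; lra.
Qed.

End Counting.

(** * Growth of the number of points *)

Section Growth.
Variables (R : realType) (m : nat) (S : rifs R m).
Local Notation r := (rifs_ratio S).
Local Notation letter := 'I_m.+1.
Implicit Types (u v : seq letter) (w : nat -> letter) (x y z : R).
Hypothesis hull : forall w, conv_hull (attractor S w) = [set` `[0, 1]].
Variable c : R.
Hypothesis c_gt0 : 0 < c.
Hypothesis sep : forall u x y, x \in pts S u -> y \in pts S u -> x != y ->
    c * r ^+ size u <= `|x - y|.

Let r_gt0 : 0 < r. Proof. exact: ratio_gt0. Qed.
Let r_lt1 : r < 1. Proof. exact: ratio_lt1. Qed.
Let rX_gt0 n : 0 < r ^+ n. Proof. exact: ratioX_gt0. Qed.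
Hint Resolve r_gt0 r_lt1 rX_gt0 : core.

Definition npts u := size (pts S u).

Lemma npts_gt0 u : (0 < npts u)%N.
Proof.
rewrite /npts; case: (pts S u) (pts_min hull u) => [|//]; by rewrite in_nil.
Qed.

Lemma npts_cat_le u v : (npts (u ++ v) <= npts u * npts v)%N.
Proof.
rewrite /npts -(size_allpairs (fun x y => x + r ^+ size u * y)).
apply: uniq_leq_size; first exact: pts_uniq.
move=> z /mem_pts_cat[x [y [xu yv ->]]].
by apply/allpairsP; exists (x, y).
Qed.

Lemma npts_le_cat u v : (npts u <= npts (u ++ v))%N.
Proof.
apply: uniq_leq_size; first exact: pts_uniq.
move=> x xu; apply/mem_pts_cat; exists x, 0; rewrite mulr0 addr0.
by rewrite (pts_min hull).
Qed.

(** By separation, a bound for the number of points of one level in an interval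
of length [t] times the scale of that level. *)
Definition mult t := (Num.truncn (t / c)).+1.

Lemma size_pts_itv u (s : seq R) a t : uniq s -> {subset s <= pts S u} ->
  {in s, forall x, a <= x <= a + t * r ^+ size u} -> (size s <= mult t)%N.
Proof.
move=> us su itv; apply: (@size_separated _ s a (c * r ^+ size u)) => //.
- exact: mulr_gt0.
- by move=> x y xs ys; apply: sep; apply: su.
- by move=> x xs; rewrite mulrA divfK ?lt0r_neq0 // itv.
Qed.

(** A sum y + r^|u| z with z in [0, 1] leaves y in an interval of length r^|u|,
and then determines z. *)
Lemma npts_cat_ge u v : (npts u * npts v <= mult 1 * npts (u ++ v))%N.
Proof.
rewrite /npts -(size_allpairs (fun x y => (x, y))).
set s := [seq _ | x <- _, y <- _].
have us : uniq s by rewrite allpairs_uniq ?pts_uniq // => -[? ?] [? ?] _ _.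
apply: (@size_le_fibres _ _ (fun p => p.1 + r ^+ size u * p.2)); last first.
  by move=> _ /allpairsP[[x y] [/= xu yv ->]]; apply/mem_pts_cat; exists x, y.
move=> z _; set s' := [seq _ <- _ | _].
have s'P p : p \in s' ->
    [/\ p.1 \in pts S u, p.2 \in pts S v & p.1 + r ^+ size u * p.2 = z].
  by rewrite mem_filter => /andP[/eqP ? /allpairsP[[x y] [/= xu yv pE]]]; subst p.
rewrite -(size_map fst); apply: (@size_pts_itv u _ (z - r ^+ size u)).
- rewrite map_inj_in_uniq ?filter_uniq // => -[x y] [x' y'].
  move=> /s'P[/= _ _ e] /s'P[/= _ _ e'] xx'.
  rewrite -xx' in e' *; congr (_, _); apply: (mulfI (lt0r_neq0 (rX_gt0 (size u)))).
  by apply: (@addrI _ x); rewrite e e'.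
- by move=> _ /mapP[p /s'P[? _ _] ->].
- move=> _ /mapP[p /s'P[_ /(pts_itv hull)/andP[p0 p1] zE] ->].
  have := rX_gt0 (size u); have := rX_gt0 (size v); rewrite -zE; nra.
Qed.

(** * Box dimension *)

Lemma ratioX_le k (d : R) : 0 < d -> (r ^+ k <= d) = (- ln d <= k%:R * - ln r).
Proof.
by move=> d0; rewrite mulrN lerN2 mulr_natl -lnXn // ler_ln ?posrE.
Qed.

Lemma ratioX_ge k (d : R) : 0 < d -> (d <= r ^+ k) = (k%:R * - ln r <= - ln d).
Proof.
by move=> d0; rewrite mulrN lerN2 mulr_natl -lnXn // ler_ln ?posrE.
Qed.

Lemma finitely_covered_pts w n (d : R) : r ^+ n <= d ->
  finitely_covered (npts (pfx w n)) d (attractor S w).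
Proof.
move=> rd; exists (fun i => [set` `[(pts S (pfx w n))`_i, (pts S (pfx w n))`_i + r ^+ n]]).
split=> [i|x].
  apply: ge_ereal_sup => _ [[x y] [/= + +] <-]; rewrite !in_itv /= lee_fin.
  set a := _`_ _; move=> /andP[? ?] /andP[? ?].
  by rewrite ler_norml; apply/andP; split; lra.
rewrite -{1}(catw_pfx_tail w n) => /(attractor_cat hull)[y [z [yp Kz ->]]].
have iy : (index y (pts S (pfx w n)) < npts (pfx w n))%N by rewrite index_mem.
exists (Ordinal iy) => //=; rewrite nth_index // in_itv /= size_pfx.
have := attractor_itv hull Kz; have := rX_gt0 n => ? /andP[? ?].
by apply/andP; split; nra.
Qed.

(** The points of level n belong to the attractor, and a set of diameter at most
r^n contains boundedly many of them. *)
Lemma npts_le_cover w n k (d : R) : d <= r ^+ n ->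
  finitely_covered k d (attractor S w) -> (npts (pfx w n) <= mult 2 * k)%N.
Proof.
move=> dr [U [dU KU]].
have Kx x : x \in pts S (pfx w n) -> exists i, U i x.
  move=> xp; have /KU[i _ Ui] : attractor S w x; last by exists i.
  by rewrite -(catw_pfx_tail w n); apply: pts_attractor.
case: k U dU KU Kx => [U _ _ Kx|k U dU KU Kx].
  by have [[]] := Kx _ (pts_min hull (pfx w n)).
pose f x := xget ord0 [set i | U i x].
have Uf x : x \in pts S (pfx w n) -> U (f x) x by move=> /Kx/(xgetPex ord0).
rewrite -[X in (_ * X)%N]card_ord cardE.
apply: (@size_le_fibres _ _ f) => [i _|x _]; last by rewrite mem_enum.
set s := [seq _ <- _ | _].
have sP x : x \in s -> x \in pts S (pfx w n) /\ U i x.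
  by rewrite mem_filter => /andP[/eqP<- xp]; split => //; exact: Uf.
case E : s => [//|x0 s0]; rewrite -E.
apply: (@size_pts_itv (pfx w n) _ (x0 - r ^+ n)).
- exact/filter_uniq/pts_uniq.
- by move=> x /sP[].
move=> x /sP[_ Ux]; have [_ Ux0] : x0 \in pts S (pfx w n) /\ U i x0.
  by apply: sP; rewrite E mem_head.
rewrite size_pfx; have : (`|x - x0|%:E <= (r ^+ n)%:E)%E.
  apply: le_trans (_ : (d%:E <= _)%E); last by rewrite lee_fin.
  by apply: le_trans (dU i); apply: ereal_sup_ubound; exists (x, x0).
rewrite lee_fin ler_norml => /andP[? ?]; apply/andP; split; lra.
Qed.

Lemma covering_numberP (A : set R) (d : R) k : finitely_covered k d A ->
  finitely_covered (covering_number d A) d A /\ (covering_number d A <= k)%N.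
Proof.
move=> hk; rewrite /covering_number; set Q := [set n | _].
have ex : exists n, `[< finitely_covered n d A >] by exists k; apply/asboolP.
have : exists n, Q n.
  case: (ex_minnP ex) => n /asboolP nd nmin; exists n; split => // j jd.
  by apply: nmin; apply/asboolP.
by move=> /(xgetPex 0%N)[h1 h2]; split => //; exact: h2.
Qed.

(** Squeeze the diameter between consecutive powers of r. *)
Lemma box_dimension w (L : R) :
  ln (npts (pfx w n))%:R / (n%:R * - ln r) @[n --> \oo] --> L ->
  has_box_dimension (attractor S w) L.
Proof.
set x := (X in X @ _) => xL; set l := - ln r.
have l0 : 0 < l by rewrite oppr_gt0 ln_lt0 // r_gt0.
have M1 n : 1 <= (npts (pfx w n))%:R :> R by rewrite ler1n npts_gt0.
have M0 n : 0 < (npts (pfx w n))%:R :> R by rewrite ltr0n npts_gt0.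
pose K : R := ln (mult 2)%:R.
(* Bounds for the quotient at diameters between r^(n + 2) and r^(n + 1); the
   shift by one keeps the denominators nonzero. *)
pose lo n := x n.+1 * (1 - harmonic n.+1) - K / l * harmonic n.+1.
pose up n := x n.+2 * (1 + harmonic n).
pose p d := (Num.truncn (ln d / ln r)).-1.
have hS : harmonic n.+1 @[n --> \oo] --> (0 : R).
  by rewrite (cvg_shiftS (@harmonic R)); exact: cvg_harmonic.
have loL : lo n @[n --> \oo] --> L.
  rewrite -[L](_ : L * (1 - 0) - K / l * 0 = L); last by ring.
  apply: cvgB; last by apply: cvgM => //; exact: cvg_cst.
  apply: cvgM; first by rewrite (cvg_shiftS x).
  by apply: cvgB => //; exact: cvg_cst.
have upL : up n @[n --> \oo] --> L.
  rewrite -[L](_ : L * (1 + 0) = L); last by ring.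
  apply: cvgM; first by rewrite (cvg_shiftS (fun n => x n.+1)) (cvg_shiftS x).
  by apply: cvgD; [exact: cvg_cst|exact: cvg_harmonic].
have pP (d : R) : 0 < d -> d < r -> r ^+ (p d).+2 <= d <= r ^+ (p d).+1.
  move=> d0 dr.
  have q1 : 1 <= ln d / ln r.
    rewrite -[ln d / ln r]mulrNN -invrN -/l ler_pdivlMr // mul1r lerN2.
    by rewrite ler_ln ?posrE ?ltW.
  have := truncn_itv (le_trans ler01 q1).
  have pE : (p d).+1 = Num.truncn (ln d / ln r) by rewrite prednK // truncn_gt0.
  rewrite -pE -[ln d / ln r]mulrNN -invrN -/l ler_pdivlMr // ltr_pdivrMr //.
  by move=> /andP[h1 h2]; rewrite ratioX_le // ratioX_ge // h1 ltW.
have near_itv (b : R) : 0 < b -> \forall d \near 0^'+, 0 < d < b.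
  move=> b0; near=> d; apply/andP; split.
    by near: d; exact: nbhs_right_gt.
  by near: d; exact: nbhs_right_lt.
have pinf : p d @[d --> 0^'+] --> \oo.
  apply/cvgnyPge => A; near=> d.
  have /andP[d0 dA] : 0 < d < r ^+ A.+2 by near: d; apply: near_itv.
  have dr : d < r.
    by apply: lt_le_trans dA _; rewrite exprS ler_piMr ?ratioX_le1 // ltW.
  have /andP[h _] := pP _ d0 dr; rewrite leqNgt; apply/negP => pA.
  have : r ^+ A.+2 <= r ^+ (p d).+2 
    by rewrite ler_wiXn2l ?(ltW r_gt0) ?(ltW r_lt1) // !ltnS ltnW.
  by rewrite leNgt (le_lt_trans h dA).
have squeeze : \forall d \near 0^'+,
    (lo \o p) d <= ln (covering_number d (attractor S w))%:R / - ln d <= (up \o p) d.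
  near=> d.
  have /andP[d0 dr] : 0 < d < r by near: d; exact: near_itv.
  have /andP[d1 d2] := pP _ d0 dr; rewrite /lo /up /=; move: (p d) d1 d2 => k d1 d2.
  have [cov covle] := covering_numberP (finitely_covered_pts w d1).
  have covge := npts_le_cover d2 cov; move: (covering_number _ _) covge covle => C CK Ck.
  have C1 : (0 < C)%N.
    by move: CK (npts_gt0 (pfx w k.+1)); case: (C) => //; rewrite muln0 leqn0 => /eqP->.
  have lnd2 : k.+1%:R * l <= - ln d.
    by rewrite -ratioX_ge.
  have lnd1 : - ln d <= k.+2%:R * l.
    by rewrite -ratioX_le.
  have lnC0 : 0 <= ln C%:R :> R by rewrite ln_ge0 // ler1n.
  have lnC2 : ln C%:R <= ln (npts (pfx w k.+2))%:R :> R.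
    by rewrite ler_ln ?posrE ?ltr0n ?npts_gt0 // ler_nat.
  have lnC1 : ln (npts (pfx w k.+1))%:R <= K + ln C%:R :> R.
    rewrite -lnM ?posrE ?ltr0n // -natrM ler_ln ?posrE ?ltr0n ?npts_gt0 ?muln_gt0 //.
    by rewrite ler_nat.
  have k1 : 0 < k.+1%:R :> R by [].
  have k2 : 0 < k.+2%:R :> R by [].
  have lnd0 : 0 < - ln d by apply: lt_le_trans lnd2; exact: mulr_gt0.
  apply/andP; split.
    rewrite ler_pdivlMr // 
      (_ : _ - _ = (ln (npts (pfx w k.+1))%:R - K) / (k.+2%:R * l)); last first.
      rewrite /x /= -/l.
      move: (k.+1%:R) (k.+2%:R) (esym (natr1 (R := R) k.+1)) k1 k2 => a b -> a0 b0.
      by field; rewrite !lt0r_neq0.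
    rewrite mulrAC ler_pdivrMr; last exact: mulr_gt0.
    apply: le_trans (_ : ln C%:R * - ln d <= _); last by rewrite ler_wpM2l.
    by rewrite ler_wpM2r ?(ltW lnd0) // lerBlDl.
  rewrite ler_pdivrMr // 
    (_ : _ * (1 + _) = ln (npts (pfx w k.+2))%:R / (k.+1%:R * l)); last first.
    rewrite /x /= -/l.
    move: (k.+1%:R) (k.+2%:R) (esym (natr1 (R := R) k.+1)) k1 k2 => a b -> a0 b0.
    by field; rewrite !lt0r_neq0.
  rewrite mulrAC ler_pdivlMr; last exact: mulr_gt0.
  apply: ler_pM => //; exact/ltW/mulr_gt0.
apply: (squeeze_cvgr squeeze).
- by apply: cvg_comp pinf _.
- by apply: cvg_comp pinf _.
Unshelve. all: by end_near.
Qed.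

End Growth.

(** * Hausdorff dimension *)

Section Hausdorff.
Variables (R : realType) (m : nat) (S : rifs R m).
Local Notation r := (rifs_ratio S).
Local Notation letter := 'I_m.+1.
Implicit Types (u v : seq letter) (w : nat -> letter) (x y z s : R).
Hypothesis hull : forall w, conv_hull (attractor S w) = [set` `[0, 1]].
Variable c : R.
Hypothesis c_gt0 : 0 < c.
Hypothesis sep : forall u x y, x \in pts S u -> y \in pts S u -> x != y ->
    c * r ^+ size u <= `|x - y|.

Let r_gt0 : 0 < r. Proof. exact: ratio_gt0. Qed.
Let r_lt1 : r < 1. Proof. exact: ratio_lt1. Qed.
Let rX_gt0 n : 0 < r ^+ n. Proof. exact: ratioX_gt0. Qed.
Hint Resolve r_gt0 r_lt1 rX_gt0 : core.
Local Notation l := (- ln r).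
Let l_gt0 : 0 < l. Proof. by rewrite oppr_gt0 ln_lt0 // r_gt0. Qed.

Lemma powR_ratioX n s : (r ^+ n) `^ s = expR (- (n%:R * l * s)).
Proof.
rewrite /powR (negbTE (lt0r_neq0 (rX_gt0 n))) lnXn // -mulr_natl.
by congr expR; ring.
Qed.

Lemma hausdorff_weight_ge0 s (U : set R) : (0 <= hausdorff_weight s U)%E.
Proof. by rewrite /hausdorff_weight; case: ifP => // _; exact: poweR_ge0. Qed.

Lemma hausdorff_premeasure_ge0 s d (A : set R) : (0 <= hausdorff_premeasure s d A)%E.
Proof.
apply: le_ereal_inf_tmp => _ [U _ <-].
by apply: nneseries_ge0 => i _ _; exact: hausdorff_weight_ge0.
Qed.

Lemma diam_ge0 (U : set R) : U !=set0 -> (0 <= diam U)%E.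
Proof.
move=> [x Ux]; apply: ereal_sup_ubound; exists (x, x) => //.
by rewrite /= subrr normr0.
Qed.

Lemma hausdorff_premeasure_le s w n d : 0 <= s -> r ^+ n <= d ->
  (hausdorff_premeasure s d (attractor S w) <=
     ((npts S (pfx w n))%:R * (r ^+ n) `^ s)%:E)%E.
Proof.
move=> s0 rd; have [V [dV KV]] := finitely_covered_pts hull w (lexx (r ^+ n)).
set k := npts _ _ in V dV KV *.
pose U i := if insub i is Some j then V j else set0.
have dU i : (diam (U i) <= (r ^+ n)%:E)%E.
  rewrite /U; case: insubP => [j _ _|_]; first exact: dV.
  by apply: ge_ereal_sup => _ [p [[]]].
apply: le_trans (_ : (\sum_(0 <= i <oo) hausdorff_weight s (U i) <= _)%E).
  apply: ereal_inf_lbound; exists U => //; split=> [i|x Kx].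
    by apply: le_trans (dU i) _; rewrite lee_fin.
  by have [i _ Vi] := KV _ Kx; exists (i : nat) => //; rewrite /U valK.
apply: lime_le.
  by apply: is_cvg_nneseries => i _ _; exact: hausdorff_weight_ge0.
apply: nearW => j.
have : (\sum_(0 <= i < j) hausdorff_weight s (U i) <= ((minn j k)%:R * (r ^+ n) `^ s)%:E)%E.
  elim: j => [|j IH]; first by rewrite big_nil min0n mul0r.
  rewrite big_nat_recr //=; apply: le_trans (leeD IH (lexx _)) _.
  rewrite /hausdorff_weight; case: ifPn => [/asboolP _|/asboolP U0].
    rewrite adde0 lee_fin ler_wpM2r ?powR_ge0 // ler_nat.
    by rewrite leq_min geq_minr andbT; apply: leq_trans (geq_minl _ _) _.
  have jk : (j < k)%N.
    by rewrite ltnNge; apply/negP => kj; apply: U0; rewrite /U insubF // ltnNge kj.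
  rewrite (minn_idPl jk) (minn_idPl (ltnW jk)) -natr1 mulrDl mul1r EFinD leeD2l //.
  rewrite -poweR_EFin gt0_ler_poweR // !in_itv /= ?lee_fin ?leey ?andbT ?(ltW (rX_gt0 n)) //.
  by rewrite diam_ge0 //; apply/set0P/eqP.
move=> /le_trans; apply; rewrite lee_fin ler_wpM2r ?powR_ge0 // ler_nat.
exact: geq_minr.
Qed.

(** The scale is the last one that is at least the diameter. For a set of
diameter 0 there is no last one, and a scale of weight at most [e] will do,
or any scale if [s] is 0. *)
Lemma enlarge_cover_set s n0 (U : set R) (e : R) : 0 <= s -> 0 < e ->
  U !=set0 -> (diam U <= (r ^+ n0)%:E)%E ->
  exists a k, [/\ (n0 <= k)%N, U `<=` ball a (2 * r ^+ k) &
    (((r ^+ k.+1) `^ s)%:E <= hausdorff_weight s U + e%:E)%E].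
Proof.
move=> s0 e0 Une dU; have d0 := diam_ge0 Une; have [a Ua] := Une.
have diamU x : U x -> (`|a - x|%:E <= diam U)%E.
  by move=> Ux; apply: ereal_sup_ubound; exists (a, x).
have -> : hausdorff_weight s U = poweR (diam U) s.
  rewrite /hausdorff_weight; case: ifPn => // /asboolP U0.
  by move: Une; rewrite U0 => /set0P/eqP.
move: (diam U) d0 dU diamU => [d||]//; rewrite !lee_fin => d0 dr dU.
have sub k : d <= r ^+ k -> U `<=` ball a (2 * r ^+ k).
  move=> dk x /dU; rewrite lee_fin => xd; rewrite /ball /= .
  by have := rX_gt0 k; lra.
rewrite poweR_EFin; have [d1|d1] := eqVneq d 0.
  exists a; have [s1|s1] := eqVneq s 0.
    exists n0; split=> //; first exact: sub.
    by rewrite s1 !powRr0 -EFinD lee_fin ler_wpDr // ltW.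
  have s2 : 0 < s by rewrite lt_neqAle eq_sym s1.
  have [k kf] := ratioX_small S (powR_gt0 s^-1 e0).
  exists (maxn n0 k); split; first exact: leq_maxl.
    by apply: sub; rewrite d1 ltW.
  rewrite -EFinD lee_fin ler_wpDl ?powR_ge0 //.
  rewrite -[leRHS](powRr1 (ltW e0)) -(mulVf (lt0r_neq0 s2)) powRrM.
  rewrite ge0_ler_powR ?nnegrE ?powR_ge0 // ?(ltW (rX_gt0 _)) //.
  apply: le_trans (ltW kf); rewrite ler_wiXn2l ?(ltW r_gt0) ?(ltW r_lt1) //.
  by apply: leqW; exact: leq_maxr.
have d2 : 0 < d by rewrite lt_neqAle eq_sym d1.
case: (ex_minnP (ratioX_small S d2)) => -[|k].
  by have := ratioX_le1 S n0; rewrite expr0; lra.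
move=> kd kmin; have dk : d <= r ^+ k.
  by rewrite leNgt; apply/negP => /kmin; rewrite ltnn.
exists a, k; split; [|exact: sub|].
  rewrite leqNgt; apply/negP => kn.
  have : r ^+ n0 <= r ^+ k.+1 by rewrite ler_wiXn2l ?ltW.
  by lra.
rewrite -EFinD lee_fin; apply: le_trans (_ : d `^ s <= _); last by rewrite lerDl ltW.
by rewrite ge0_ler_powR ?nnegrE // ltW.
Qed.

(** Quasi-multiplicativity makes the points of level [n] equidistributed at
every earlier scale: below each point of level [k] there are about M_n / M_k. *)
Lemma npts_ball w n k (a : R) : (k <= n)%N ->
  (size [seq x <- pts S (pfx w n) | (`|a - x| < 2 * r ^+ k)%R] * npts S (pfx w k)
    <= mult c 5 * mult c 1 * npts S (pfx w n))%N.
Proof.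
move=> kn; set s := [seq _ <- _ | _].
set v := pfx (tail k w) (n - k).
have pE : pfx w n = pfx w k ++ v by rewrite -pfxD subnKC.
apply: leq_trans (_ : mult c 5 * npts S v * npts S (pfx w k) <= _)%N; last first.
  by rewrite -!mulnA leq_mul2l mulnC pE npts_cat_ge ?orbT.
rewrite leq_mul2r; apply/orP; right.
(* A basic interval of length r^k that meets the ball of radius 2 r^k starts at
   distance at most 3 r^k to the left of the centre, or 2 r^k to the right. *)
set t := [seq y <- pts S (pfx w k) | a - 3 * r ^+ k <= y <= a - 3 * r ^+ k + 5 * r ^+ k].
apply: leq_trans (_ : size t * npts S v <= _)%N.
  rewrite -(size_allpairs (fun x y => x + r ^+ k * y)).
  apply: uniq_leq_size; first exact/filter_uniq/pts_uniq.
  move=> x; rewrite mem_filter pE => /andP[xa /mem_pts_cat[y [z [yk zv xE]]]].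
  apply/allpairsP; exists (y, z); split => //=; last by rewrite xE size_pfx.
  rewrite mem_filter yk andbT; have /andP[z0 z1] := pts_itv hull zv.
  have := rX_gt0 k; have := rX_gt0 (size v); move: xa.
  rewrite xE size_pfx ltr_norml => /andP[? ?] ? ?; apply/andP; split; nra.
rewrite leq_mul2r; apply/orP; right.
apply: (size_pts_itv c_gt0 sep (u := pfx w k) (a := a - 3 * r ^+ k)).
- exact/filter_uniq/pts_uniq.
- by move=> x; rewrite mem_filter => /andP[].
- by move=> x; rewrite mem_filter size_pfx => /andP[].
Qed.

(** The mass distribution principle, with the uniform measure on the points of
one deep level instead of a limit measure: by compactness finitely many of the
enlarged sets cover the attractor, and a level deeper than all their scales
bounds the sum of their weights from below. *)
Lemma hausdorff_premeasure_gt0 s w n0 : 0 <= s ->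
  (forall n, (n0 <= n)%N -> 1 <= (npts S (pfx w n))%:R * (r ^+ n) `^ s) ->
  (0 < hausdorff_premeasure s (r ^+ n0) (attractor S w))%E.
Proof.
move=> s0 big; rewrite ltNge; apply/negP => small.
pose C : R := (mult c 5 * mult c 1)%:R.
have C0 : 0 < C by rewrite ltr0n muln_gt0.
(* The total error is at most [e] as well, and 2 C e < r^s is the contradiction. *)
pose e := r `^ s / (4 * C).
have rs0 : 0 < r `^ s by rewrite powR_gt0.
have e0 : 0 < e by rewrite divr_gt0 // mulr_gt0.
have [U [dU KU] We] : exists2 U : nat -> set R,
    (forall i, (diam (U i) <= (r ^+ n0)%:E)%E) /\ attractor S w `<=` \bigcup_i U i &
    (\sum_(0 <= i <oo) hausdorff_weight s (U i) < e%:E)%E.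
  have : (hausdorff_premeasure s (r ^+ n0) (attractor S w) < e%:E)%E.
    by apply: le_lt_trans small _; rewrite lte_fin.
  by move=> /ereal_inf_lt[_ [U HU <-]] ?; exists U.
pose eta i := e / 2 ^+ i.+1.
have eta0 i : 0 < eta i by rewrite divr_gt0 // exprn_gt0.
pose good i (p : R * nat) := U i !=set0 ->
  [/\ (n0 <= p.2)%N, U i `<=` ball p.1 (2 * r ^+ p.2) &
  (((r ^+ p.2.+1) `^ s)%:E <= hausdorff_weight s (U i) + (eta i)%:E)%E].
have /choice[ak akP] : forall i, exists p, good i p.
  move=> i; have [U0|U0] := pselect (U i !=set0); last by exists (0, 0%N).
  have [a [k ?]] := enlarge_cover_set s0 (eta0 i) U0 (dU i).
  by exists (a, k).
have [_ cK _] := attractorP hull w.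
move: cK; rewrite compact_cover.
move=> /(_ nat [set i | U i !=set0] (fun i => ball (ak i).1 (2 * r ^+ (ak i).2))).
case=> [i _|x Kx|D Dsub KD].
- apply: ball_open; exact: mulr_gt0.
- have [i _ Ui] := KU _ Kx; have U0 : U i !=set0 by exists x.
  by exists i => //; have [_ h _] := akP i U0; exact: h.
pose N := (\max_(i <- D) i).+1.
have DN i : i \in D -> (i < N)%N by move=> iD; rewrite ltnS leq_bigmax_seq.
pose n := maxn n0 (\max_(i < N) (ak i).2).
pose Q i x := (i \in D) && (`|(ak i).1 - x| < 2 * r ^+ (ak i).2).
pose W i := hausdorff_weight s (U i).
have W0 i : (0 <= W i)%E by exact: hausdorff_weight_ge0.
have sumW j : (\sum_(0 <= i < j) W i < e%:E)%E.
  by apply: le_lt_trans We; apply: nneseries_lim_ge.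
have Wfin i : W i \is a fin_num.
  rewrite ge0_fin_numE //; apply: le_lt_trans (lt_trans (sumW i.+1) (ltry e)).
  by rewrite big_nat_recr //= leeDr // sume_ge0.
(* As M_k r^(k s) >= 1, the i-th ball has at most C M_n r^(k s) points. *)
have count_le i : (i < N)%N ->
    (size [seq x <- pts S (pfx w n) | Q i x])%:R * r `^ s
      <= C * (npts S (pfx w n))%:R * (fine (W i) + eta i).
  move=> iN; have F0 : 0 <= fine (W i) + eta i.
    by rewrite addr_ge0 ?fine_ge0 ?(ltW (eta0 i)).
  rewrite /Q; case iD : (i \in D); last first.
    by rewrite filter_pred0 mul0r !mulr_ge0 // ltW.
  have /akP[n0k _] : U i !=set0 by have := Dsub i iD; rewrite inE.
  move=> h0; have : (r ^+ (ak i).2.+1) `^ s <= fine (W i) + eta i.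
    by rewrite -lee_fin EFinD fineK.
  rewrite exprS powRM ?(ltW r_gt0) ?(ltW (rX_gt0 _)) // => h {h0}.
  have kn : ((ak i).2 <= n)%N.
    by rewrite leq_max; apply/orP; right; rewrite (leq_bigmax (Ordinal iN)).
  have : (size [seq x <- pts S (pfx w n) | `|(ak i).1 - x| < 2 * r ^+ (ak i).2])%:R *
      (npts S (pfx w (ak i).2))%:R <= C * (npts S (pfx w n))%:R.
    by rewrite /C -!natrM ler_nat npts_ball.
  have := big _ n0k.
  move: ((r ^+ (ak i).2) `^ s) (powR_ge0 (r ^+ (ak i).2) s) h => b b0 h Mb.
  set k := size _; move: k%:R (ler0n R k) => z z0 zM.
  have M0 : 0 <= C * (npts S (pfx w n))%:R by rewrite mulr_ge0 // ltW.
  apply: le_trans (_ : C * (npts S (pfx w n))%:R * (r `^ s * b) <= _); 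
    last by rewrite ler_wpM2l.
  rewrite mulrCA [leLHS]mulrC ler_wpM2l ?(ltW rs0) //.
  apply: le_trans (_ : z * (npts S (pfx w (ak i).2))%:R * b <= _); last by rewrite ler_wpM2r.
  by rewrite -mulrA ler_peMr.
have total : (npts S (pfx w n) <= \sum_(i < N) size [seq x <- pts S (pfx w n) | Q i x])%N.
  apply: size_le_sum_count => x xp.
  have /KD[i /= iD xi] : attractor S w x.
    by rewrite -(catw_pfx_tail w n); apply: pts_attractor.
  by exists i; [exact: DN|rewrite /Q iD].
have sumeta j : \sum_(i < j) eta i <= e.
  suff : \sum_(i < j) eta i = e * (1 - (2 ^+ j)^-1).
    by move=> ->; rewrite ler_piMr ?ltW // gerBl invr_ge0 exprn_ge0.
  elim: j => [|j IH]; first by rewrite big_ord0 expr0 invr1 subrr mulr0.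
  by rewrite big_ord_recr /= IH /eta exprS; field; rewrite expf_neq0.
have sumF : \sum_(i < N) fine (W i) <= e.
  rewrite -lee_fin -sumEFin -(big_mkord xpredT (fun i => (fine (W i))%:E)).
  by apply: ltW; under eq_bigr do rewrite fineK //; exact: sumW.
have Mn0 : 0 < (npts S (pfx w n))%:R :> R by rewrite ltr0n npts_gt0.
have : (npts S (pfx w n))%:R * r `^ s <= C * (npts S (pfx w n))%:R * (e + e).
  apply: le_trans (_ : (\sum_(i < N) size [seq x <- pts S (pfx w n) | Q i x])%:R * r `^ s <= _).
    by rewrite ler_wpM2r ?(ltW rs0) // ler_nat.
  rewrite natr_sum mulr_suml.
  apply: le_trans (ler_sum _ (fun (i : 'I_N) _ => count_le i (ltn_ord i))) _.
  rewrite -mulr_sumr ler_wpM2l //; first by rewrite mulr_ge0 // ltW.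
  by rewrite big_split /=; exact: lerD sumF (sumeta N).
rewrite [C * _]mulrC -mulrA ler_pM2l //.
rewrite leNgt => /negP; apply.
rewrite (_ : C * (e + e) = r `^ s / 2); last first.
  by rewrite /e; move: (C) C0 => C' C'0; field; exact: lt0r_neq0.
by rewrite ltr_pdivrMr // ltr_pMr // ltr1n.
Qed.

Lemma hausdorff_dimension_attractor w (L : R) :
  ln (npts S (pfx w n))%:R / (n%:R * - ln r) @[n --> \oo] --> L ->
  hausdorff_dimension (attractor S w) = L%:E.
Proof.
set x := (X in X @ _) => xL; have l0 := l_gt0.
have M1 n : 1 <= (npts S (pfx w n))%:R :> R by rewrite ler1n npts_gt0.
have M0 n : 0 < (npts S (pfx w n))%:R :> R by rewrite ltr0n npts_gt0.
have x0 n : 0 <= x n.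
  by rewrite /x divr_ge0 ?ln_ge0 // mulr_ge0 // ltW.
have L0 : 0 <= L.
  rewrite -(cvg_lim _ xL) //; apply: limr_ge; first by apply/cvg_ex; exists L.
  exact: nearW.
have ME n t : (0 < n)%N -> (npts S (pfx w n))%:R * (r ^+ n) `^ t = expR (n%:R * l * (x n - t)).
  move=> n0; have n1 : 0 < n%:R :> R by rewrite ltr0n.
  rewrite powR_ratioX -[X in X * _](lnK (M0 n)) -expRD; congr expR.
  rewrite /x mulrBr [in RHS]mulrCA divff ?mulr1 //.
  by rewrite lt0r_neq0 // mulr_gt0.
have Hge0 t : (0 <= hausdorff_measure t (attractor S w))%E.
  apply: le_ereal_sup_tmp; exists (hausdorff_premeasure t 1 (attractor S w)).
    by exists 1 => //=.
  exact: hausdorff_premeasure_ge0.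
apply/eqP; rewrite eq_le; apply/andP; split.
  apply/lee_addgt0Pr => e e0; apply: ereal_inf_lbound; exists (L + e) => //.
  split; first by rewrite addr_ge0 // ltW.
  apply/eqP; rewrite eq_le Hge0 andbT.
  apply: ge_ereal_sup => _ [d d0 <-].
  apply/lee_addgt0Pr => f f0; rewrite add0e.
  have small (q : R) (b : R) : 0 < q -> q < 1 -> 0 < b -> \forall n \near \oo, q ^+ n < b.
    move=> q0 q1 b0; have : `|q| < 1 by rewrite ger0_norm ?ltW.
    move=> /cvg_expr /(cvgr0_norm_lt _) /(_ b b0); apply: filterS => n.
    by apply: le_lt_trans; exact: ler_norm.
  have q1 : expR (- (l * (e / 2))) < 1 by rewrite expR_lt1 oppr_lt0 mulr_gt0 ?divr_gt0.
  have xLe : \forall n \near \oo, x n < L + e / 2.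
    by apply: cvgr_lt xL _ _; rewrite ltrDl divr_gt0.
  near \oo => n.
  have n0 : (0 < n)%N by near: n; exists 1%N.
  have nd : r ^+ n < d by near: n; apply: small.
  have nf : expR (- (l * (e / 2))) ^+ n < f by near: n; apply: small => //; exact: expR_gt0.
  have nx : x n < L + e / 2 by near: n.
  apply: le_trans (hausdorff_premeasure_le (n := n) w _ (ltW nd)) _.
    by rewrite addr_ge0 // ltW.
  rewrite lee_fin ME //; apply: le_trans (ltW nf).
  rewrite -expRM_natl ler_expR -mulrA ler_wpM2l // -mulrN ler_wpM2l ?(ltW l0) //.
  by lra.
apply: le_ereal_inf_tmp => _ [t [t0 Ht] <-]; rewrite lee_fin leNgt; apply/negP => tL.
have [n0 _ hn0] : \forall n \near \oo, t <= x n by exact: cvgr_ge xL _ tL.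
have := @hausdorff_premeasure_gt0 t w n0.+1 t0.
have -> : ((0 < hausdorff_premeasure t (r ^+ n0.+1) (attractor S w)) = false)%E.
  rewrite ltNge; apply/negbF; rewrite -Ht; apply: ereal_sup_ubound.
  by exists (r ^+ n0.+1) => //=.
move=> /(_ _)/notF; apply => n n0n.
rewrite ME; last exact: leq_trans n0n.
rewrite -expR0 ler_expR mulr_ge0 ?subr_ge0 ?hn0 //=; last exact: ltnW.
by rewrite mulr_ge0 // ltW.
Unshelve. all: by end_near.
Qed.

End Hausdorff.

(** * Net intervals of a finite word *)

Section Consecutive.
Variable R : realType.
Implicit Types (s : seq R) (D : R * R) (x : R).

Lemma max_le_mem s x a : a \in s -> a <= x ->
  exists b, [/\ b \in s, b <= x & forall e, e \in s -> e <= x -> e <= b].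
Proof.
elim: s a => [//|c s IH] a; rewrite inE => /orP[/eqP->|as_] ax.
  have [[b [bs bx bmax]]|no] := pselect (exists b, [/\ b \in s, b <= x &
      forall e, e \in s -> e <= x -> e <= b]).
    have [cb|bc] := leP c b.
      exists b; split; rewrite ?inE ?bs ?orbT // => e; rewrite inE.
      by move=> /orP[/eqP->//|]; exact: bmax.
    exists c; split; rewrite ?mem_head // => e; rewrite inE.
    move=> /orP[/eqP->//|es ex]; apply: le_trans (bmax _ es ex) _; exact: ltW.
  exists c; split; rewrite ?mem_head // => e; rewrite inE.
  by move=> /orP[/eqP->//|es ex]; case: no; exact: IH es ex.
have [b [bs bx bmax]] := IH _ as_ ax.
have [cx|xc] := leP c x; last first.
  exists b; split; rewrite ?inE ?bs ?orbT // => e; rewrite inE.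
  by move=> /orP[/eqP->|]; [rewrite leNgt xc|exact: bmax].
have [cb|bc] := leP c b.
  exists b; split; rewrite ?inE ?bs ?orbT // => e; rewrite inE.
  by move=> /orP[/eqP->//|]; exact: bmax.
exists c; split; rewrite ?mem_head // => e; rewrite inE.
move=> /orP[/eqP->//|es ex]; apply: le_trans (bmax _ es ex) _; exact: ltW.
Qed.

Lemma min_ge_mem s x a : a \in s -> x <= a ->
  exists b, [/\ b \in s, x <= b & forall e, e \in s -> x <= e -> b <= e].
Proof.
move=> as_ xa.
have [||b [/mapP[b' b's ->] bx bmin]] := @max_le_mem (map -%R s) (- x) (- a).
- by rewrite map_f.
- by rewrite lerN2.
exists b'; split=> //; first by rewrite -lerN2.
by move=> e es xe; rewrite -lerN2; apply: bmin; rewrite ?map_f ?lerN2.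
Qed.

Definition consecutive s D :=
  [/\ D.1 \in s, D.2 \in s, D.1 < D.2 & forall e, e \in s -> ~ D.1 < e < D.2].

Lemma zip_beheadP s D : sorted <%R s ->
  D \in zip s (behead s) <-> consecutive s D.
Proof.
elim: s => [|a s IH] ss; first by split=> // -[].
case: s IH ss => [|b s] IH /=; 
  first by move=> _; split=> // -[]; rewrite !inE => /eqP-> /eqP->; rewrite ltxx.
move=> /andP[ab pb]; have amin e : e \in b :: s -> a < e.
  have pab : path <%R a (b :: s) by rewrite /= ab.
  by have /allP h := order_path_min lt_trans pab; exact: h.
have bmin e : e \in s -> b < e.
  by have /allP h := order_path_min lt_trans pb; exact: h.
rewrite inE; split.
  move=> /orP[/eqP->|/(IH pb)[D1 D2 D12 no]].
    split=> //=; rewrite ?inE ?eqxx ?orbT // => e; rewrite !inE => /or3P[/eqP->|/eqP->|/bmin be].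
    - by rewrite ltxx.
    - by rewrite ltxx andbF.
    - by rewrite (ltNge e) ltW ?andbF.
  split=> //; [by rewrite in_cons D1 orbT|by rewrite in_cons D2 orbT|move=> e].
  rewrite in_cons => /orP[/eqP->|]; last exact: no.
  by rewrite ltNge ltW // amin.
move=> [+ + D12 no]; rewrite !(in_cons a) => /orP[/eqP D1|D1] /orP[/eqP D2|D2].
- by move: D12; rewrite D1 D2 ltxx.
- apply/orP; left; apply/eqP; move: D2; rewrite in_cons => /orP[/eqP D2|/bmin D2].
    by rewrite [D]surjective_pairing D1 D2.
  by case: (no b); rewrite ?inE ?eqxx ?orbT // D1 ab.
- by move: D12; rewrite D2 ltNge ltW // amin.
- apply/orP; right; apply/(IH pb); split => // e es; apply: no.
  by rewrite in_cons es orbT.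
Qed.

Lemma zip_behead_sorted s : sorted <%R s ->
  sorted (fun D D' => D.1 < D'.1) (zip s (behead s)).
Proof.
case: s => [//|a s] /=; elim: s a => [//|b s IH] a /= /andP[ab pb].
by case: s IH pb => [//|c s] IH pb /=; rewrite ab; exact: (IH b pb).
Qed.

End Consecutive.

Section Net.
Variables (R : realType) (m : nat) (S : rifs R m).
Local Notation r := (rifs_ratio S).
Local Notation letter := 'I_m.+1.
Implicit Types (u v : seq letter) (w : nat -> letter) (x y z p : R) (D E : R * R).
Hypothesis hull : forall w, conv_hull (attractor S w) = [set` `[0, 1]].

Let r_gt0 : 0 < r. Proof. exact: ratio_gt0. Qed.
Let r_lt1 : r < 1. Proof. exact: ratio_lt1. Qed.
Let rX_gt0 n : 0 < r ^+ n. Proof. exact: ratioX_gt0. Qed.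
Let rX_neq0 n : r ^+ n != 0. Proof. exact/lt0r_neq0/ratioX_gt0. Qed.
Hint Resolve r_gt0 r_lt1 rX_gt0 rX_neq0 : core.

(** The end points of a level, the intervals between consecutive ones, their
lengths and their neighbour sets are all determined by a finite word. Only
[live] involves the infinite word. *)
Definition endp u : seq R := pts S u ++ [seq y + r ^+ size u | y <- pts S u].

Lemma endpP u x : x \in endp u <->
  exists y b, [/\ y \in pts S u, (b == 0) || (b == 1) & x = y + r ^+ size u * b].
Proof.
rewrite mem_cat; split.
  move=> /orP[xu|/mapP[y yu ->]]; [exists x, 0|exists y, 1].
    by rewrite mulr0 addr0 eqxx.
  by rewrite mulr1 eqxx orbT.
move=> [y [b [yu /orP[/eqP->|/eqP->] ->]]]; first by rewrite mulr0 addr0 yu.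
by rewrite mulr1; apply/orP; right; apply/mapP; exists y.
Qed.

Lemma pts_endp u y : y \in pts S u -> y \in endp u.
Proof. by rewrite mem_cat => ->. Qed.

Lemma pts_endp1 u y : y \in pts S u -> y + r ^+ size u \in endp u.
Proof. by move=> yu; rewrite mem_cat; apply/orP; right; apply/mapP; exists y. Qed.

Lemma endp_itv u x : x \in endp u -> 0 <= x <= 1.
Proof.
move=> /endpP[y [b [/(pts_itv hull)/andP[y0 y1] /orP[/eqP->|/eqP->] ->]]];
  by have := rX_gt0 (size u) => ?; apply/andP; split; lra.
Qed.

Lemma endp_min u : 0 \in endp u. Proof. exact/pts_endp/pts_min. Qed.

Lemma endp_max u : 1 \in endp u.
Proof. by rewrite -(subrK (r ^+ size u) 1); exact/pts_endp1/pts_max. Qed.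

Lemma endp_cat u v x : x \in endp (u ++ v) <->
  exists y z, [/\ y \in pts S u, z \in endp v & x = y + r ^+ size u * z].
Proof.
rewrite endpP; split.
  move=> [_ [b [/mem_pts_cat[y [z [yu zv ->]]] b01 ->]]].
  exists y, (z + r ^+ size v * b); split => //; first by apply/endpP; exists z, b.
  by rewrite size_cat exprD; ring.
move=> [y [_ [yu /endpP[z [b [zv b01 ->]]] ->]]].
exists (y + r ^+ size u * z), b; split => //; first by apply/mem_pts_cat; exists y, z.
by rewrite size_cat exprD; ring.
Qed.

Lemma endp_sub u v x : x \in endp u -> x \in endp (u ++ v).
Proof.
move=> /endpP[y [b [yu b01 ->]]]; apply/endp_cat; exists y, b; split => //.
by case/orP: b01 => /eqP->; rewrite ?endp_min ?endp_max.
Qed.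

Definition prenet u D := consecutive (endp u) D.
Definition inside D E := (D.1 <= E.1) && (E.2 <= D.2).
Definition live w D := exists2 x, attractor S w x & D.1 < x < D.2.

Lemma mem_endpoints w n : endpoints S w n =i endp (pfx w n).
Proof.
move=> x; rewrite mem_sort mem_undup.
have wP (b : R) : x \in [seq word_map sigma b | sigma : word S w n] <->
    exists2 y, y \in pts S (pfx w n) & x = y + r ^+ n * b.
  split=> [/mapP[s _ ->]|[y /word_map0P[s <-] ->]].
    exists (word_map s 0); last exact: word_mapD.
    by apply/word_map0P; exists s.
  by apply/mapP; exists s; [rewrite mem_enum|rewrite [RHS]word_mapD].
apply/idP/idP.
  rewrite mem_cat => /orP[]/wP[y yp ->]; apply/endpP; [exists y, 0|exists y, 1];
    by rewrite size_pfx eqxx ?orbT.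
move=> /endpP[y [b [yp]]]; rewrite size_pfx mem_cat => /orP[]/eqP-> xE.
  by apply/orP; left; apply/wP; exists y.
by apply/orP; right; apply/wP; exists y.
Qed.

Lemma endpoints_sorted w n : sorted <%R (endpoints S w n).
Proof. by rewrite sort_lt_sorted undup_uniq. Qed.

Lemma consecutive_eq (s t : seq R) D : s =i t -> consecutive s D <-> consecutive t D.
Proof.
move=> st; split=> -[h1 h2 h no].
  by split => //; [rewrite -st|rewrite -st|move=> e; rewrite -st; exact: no].
by split => //; [rewrite st|rewrite st|move=> e; rewrite st; exact: no].
Qed.

Lemma attractorX w n : attractor S w (r ^+ n).
Proof.
elim: n w => [|n IH] w; first by have [] := attractor_min_max hull w.
by apply/(attractor_step hull); exists 0, (r ^+ n); rewrite digits_min // add0r exprS.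
Qed.

Lemma net_intervalsP w n D :
  D \in net_intervals S w n <-> prenet (pfx w n) D /\ live w D.
Proof.
case: n => [|n].
  rewrite inE; split=> [/eqP->|[[]]].
    split; last by exists (r ^+ 1); [exact: attractorX|rewrite expr1 r_gt0 r_lt1].
    split; rewrite ?endp_min ?endp_max //= => e.
    by rewrite !inE expr0 add0r => /orP[/eqP->|/eqP->]; rewrite ltxx ?andbF.
  rewrite !inE expr0 add0r; case: D => a b /= /orP[/eqP->|/eqP->] /orP[/eqP->|/eqP->] //.
  - by rewrite ltxx.
  - by rewrite ltr10.
  - by rewrite ltxx.
rewrite /net_intervals mem_filter; split.
  move=> /andP[/asboolP[x [/= xD Kx]] /(zip_beheadP _ (endpoints_sorted w n.+1))].
  move=> /(consecutive_eq D (mem_endpoints w n.+1)); split => //.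
  by exists x => //; move: xD; rewrite in_itv.
move=> [/(consecutive_eq D (mem_endpoints w n.+1)) DD [x Kx xD]].
apply/andP; split; last exact/(zip_beheadP _ (endpoints_sorted w n.+1)).
by apply/asboolP; exists x; split => //=; rewrite in_itv.
Qed.

Lemma net_intervals_sorted w n : sorted (fun D D' => D.1 < D'.1) (net_intervals S w n).
Proof.
case: n => [//|n]; apply: sorted_filter; first by move=> ? ? ?; exact: lt_trans.
exact/zip_behead_sorted/endpoints_sorted.
Qed.

Lemma net_intervals_uniq w n : uniq (net_intervals S w n).
Proof.
by apply: sorted_uniq (net_intervals_sorted w n) => [? ? ?|?]; [exact: lt_trans|exact: ltxx].
Qed.

Definition nlen u D : R := r ^- size u * (D.2 - D.1).
Definition nset u D : seq R :=
  sort <=%R (undup [seq r ^- size u * (D.1 - y) | y <- pts S u &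
    (y <= D.1) && (D.2 <= y + r ^+ size u)]).

Lemma norm_lengthE w n D : norm_length S n D = nlen (pfx w n) D.
Proof. by rewrite /nlen size_pfx. Qed.

Lemma mem_nset u D x : x \in nset u D <-> exists2 y, y \in pts S u &
  [/\ y <= D.1, D.2 <= y + r ^+ size u & x = r ^- size u * (D.1 - y)].
Proof.
rewrite mem_sort mem_undup; split.
  by move=> /mapP[y]; rewrite mem_filter => /andP[/andP[? ?] ?] ->; exists y.
move=> [y yu [y1 y2 ->]]; apply/mapP; exists y => //.
by rewrite mem_filter y1 y2.
Qed.

Lemma neighbour_setE w n D : D.1 <= D.2 -> neighbour_set S w n D = nset (pfx w n) D.
Proof.
move=> D12; apply: lt_sorted_eq; rewrite ?sort_lt_sorted ?undup_uniq //.
move=> x; rewrite mem_sort mem_undup; apply/idP/idP.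
  move=> /mapP[s]; rewrite mem_filter => /andP[/asboolP sub _] ->.
  apply/mem_nset; rewrite size_pfx; exists (word_map s 0); first by apply/word_map0P; exists s.
  have := sub D.1; have := sub D.2; rewrite /cc /= !in_itv /= !lexx D12.
  move=> /(_ isT)[a + <-] /(_ isT)[b + <-].
  rewrite /= !in_itv /= => /andP[a0 a1] /andP[b0 b1].
  rewrite [word_map s a]word_mapD [word_map s b]word_mapD.
  by have := rX_gt0 n => ?; split => //; nra.
move=> /mem_nset[y /word_map0P[s sE]]; rewrite size_pfx => -[y1 y2 ->].
apply/mapP; exists s; last by rewrite sE.
rewrite mem_filter mem_enum andbT.
apply/asboolP => t; rewrite /cc /= in_itv /= => /andP[t1 t2].
exists (r ^- n * (t - y)); last first.
  by rewrite word_mapD sE mulVKf // addrC subrK.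
have rn := rX_gt0 n; rewrite /= in_itv /= mulrC divr_ge0 ?(ltW rn) ?subr_ge0 //=; last lra.
by rewrite ler_pdivrMr // mul1r; lra.
Qed.

Lemma char_vectorE w n D : prenet (pfx w n) D ->
  char_vector S w n D = (nlen (pfx w n) D, nset (pfx w n) D, sibling_rank S w n D).
Proof. by move=> [_ _ /ltW D12 _]; rewrite /char_vector (norm_lengthE w) neighbour_setE. Qed.

(** No end point of the level lies strictly inside, so a basic interval of the
level that meets the interior covers. *)
Lemma prenet_cover u D y x : prenet u D -> y \in pts S u -> D.1 < x < D.2 ->
  y <= x <= y + r ^+ size u -> y <= D.1 /\ D.2 <= y + r ^+ size u.
Proof.
move=> [_ _ _ no] yu /andP[x1 x2] /andP[y1 y2]; split; rewrite leNgt; apply/negP => h.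
  by apply: (no _ (pts_endp yu)); rewrite h (le_lt_trans y1).
by apply: (no _ (pts_endp1 yu)); rewrite h (lt_le_trans x1).
Qed.

Lemma prenet_eq u D D' x : prenet u D -> prenet u D' ->
  D.1 < x < D.2 -> D'.1 < x < D'.2 -> D = D'.
Proof.
move=> [D1 D2 _ no] [D1' D2' _ no'] /andP[x1 x2] /andP[x1' x2'].
have e1 : D.1 = D'.1.
  apply/eqP; rewrite eq_le !leNgt; apply/andP; split; apply/negP => h.
    by apply: (no' _ D1); rewrite h (lt_trans x1).
  by apply: (no _ D1'); rewrite h (lt_trans x1').
have e2 : D.2 = D'.2.
  apply/eqP; rewrite eq_le !leNgt; apply/andP; split; apply/negP => h.
    by apply: (no _ D2'); rewrite h (lt_trans _ x2').
  by apply: (no' _ D2); rewrite h (lt_trans _ x2).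
by move: e1 e2; case: (D) (D') => ? ? [? ?] /= -> ->.
Qed.

Lemma prenet_inside_eq u v D D' E : prenet u D -> prenet u D' ->
  prenet (u ++ v) E -> inside D E -> inside D' E -> D = D'.
Proof.
move=> pD pD' [_ _ E12 _] /andP[h1 h2] /andP[h3 h4].
by apply: (prenet_eq (x := (E.1 + E.2) / 2) pD pD'); apply/andP; split; lra.
Qed.

(** The end points of a level remain end points, because 0 and 1 are end points
of every level. *)
Lemma prenet_parent u v E : prenet (u ++ v) E -> exists2 D, prenet u D & inside D E.
Proof.
move=> [E1 E2 E12 no].
have [b1 [b1u b1E b1max]] := max_le_mem (endp_min u) (andP (endp_itv E1)).1.
have [b2 [b2u b2E b2min]] := min_ge_mem (endp_max u) (andP (endp_itv E2)).2.
exists (b1, b2); last by rewrite /inside b1E b2E.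
split => //=; first exact: le_lt_trans b1E (lt_le_trans E12 b2E).
move=> e eu /andP[e1 e2]; apply: (no e); first exact: endp_sub.
rewrite !ltNge; apply/andP; split; apply/negP => h.
  by move: e1; rewrite ltNge b1max.
by move: e2; rewrite ltNge b2min.
Qed.

Lemma inside_trans D E F : inside D E -> inside E F -> inside D F.
Proof.
move=> /andP[a b] /andP[c d].
by apply/andP; split; [exact: le_trans a c|exact: le_trans d b].
Qed.

(** The interval of the first level around the deepest one is unique. *)
Lemma prenet_nested u v v' D E F : prenet (u ++ v) D -> prenet u E ->
  prenet ((u ++ v) ++ v') F -> inside D F -> inside E F -> inside E D.
Proof.
move=> pD pE pF DF EF; have [E' pE' E'D] := prenet_parent pD.
rewrite -catA in pF.
by rewrite (prenet_inside_eq pE pE' pF EF (inside_trans E'D DF)).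
Qed.

Lemma live_inside w D E : inside D E -> live w E -> live w D.
Proof.
move=> /andP[h1 h2] [x Kx /andP[x1 x2]]; exists x => //.
by rewrite (le_lt_trans h1) // (lt_le_trans x2).
Qed.

(** A basic interval that meets the interior covers the whole interval, so the
attractor is seen through the neighbours alone: the past enters only through the
normalized length and the neighbour set. *)
Lemma liveP u w D : prenet u D -> live (catw u w) D <->
  exists p z, [/\ p \in nset u D, attractor S w z & 0 < z - p < nlen u D].
Proof.
move=> pD; have rn := rX_gt0 (size u); split.
  move=> [x /(attractor_cat hull)[y [z [yu Kz xE]]] xD].
  have /andP[z0 z1] := attractor_itv hull Kz.
  have [|y1 y2] := prenet_cover pD yu xD; first by rewrite xE; apply/andP; split; nra.
  exists (r ^- size u * (D.1 - y)), z; split => //; first by apply/mem_nset; exists y.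
  have -> : z = r ^- size u * (x - y) by rewrite xE addrC addKr mulKf.
  have {xD}/andP[x1 x2] := xD.
  rewrite /nlen -mulrBr pmulr_rgt0 ?invr_gt0 // ltr_pM2l ?invr_gt0 //.
  by apply/andP; split; lra.
move=> [p [z [/mem_nset[y yu [y1 y2 ->]] Kz]]].
have {1 2}-> : z = r ^- size u * (y + r ^+ size u * z - y) by rewrite addrC addKr mulKf.
rewrite /nlen -mulrBr pmulr_rgt0 ?invr_gt0 // ltr_pM2l ?invr_gt0 // => /andP[h1 h2].
exists (y + r ^+ size u * z); first by apply/(attractor_cat hull); exists y, z.
by apply/andP; split; lra.
Qed.

End Net.

(** * Types of net intervals *)

Section Types.
Variables (R : realType) (m : nat) (S : rifs R m).
Local Notation r := (rifs_ratio S).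
Local Notation letter := 'I_m.+1.
Implicit Types (u v : seq letter) (w : nat -> letter) (x y z p : R) (D E : R * R).
Hypothesis hull : forall w, conv_hull (attractor S w) = [set` `[0, 1]].

Let r_gt0 : 0 < r. Proof. exact: ratio_gt0. Qed.
Let r_lt1 : r < 1. Proof. exact: ratio_lt1. Qed.
Let rX_gt0 n : 0 < r ^+ n. Proof. exact: ratioX_gt0. Qed.
Let rX_neq0 n : r ^+ n != 0. Proof. exact/lt0r_neq0/ratioX_gt0. Qed.
Hint Resolve r_gt0 r_lt1 rX_gt0 rX_neq0 : core.

Definition same_type u D u' D' := nlen S u D = nlen S u' D' /\ nset S u D = nset S u' D'.

Lemma same_type_sym u D u' D' : same_type u D u' D' -> same_type u' D' u D.
Proof. by case=> e1 e2; split. Qed.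

Lemma same_type_trans u D u' D' u'' D'' :
  same_type u D u' D' -> same_type u' D' u'' D'' -> same_type u D u'' D''.
Proof. by case=> e1 e2 [e3 e4]; split; [rewrite e1|rewrite e2]. Qed.

(** The increasing affine map from [D] to [D'], for intervals of the same
normalized length. *)
Definition rescale u D u' D' x := D'.1 + r ^+ size u' * (r ^- size u * (x - D.1)).
Definition rescale2 u D u' D' E := (rescale u D u' D' E.1, rescale u D u' D' E.2).

Section Transfer.
Variables (u u' : seq letter) (D D' : R * R).
Hypotheses (pD : prenet S u D) (pD' : prenet S u' D') (DD' : same_type u D u' D').

Lemma rescale_lt x y : (rescale u D u' D' x < rescale u D u' D' y) = (x < y).
Proof.
by rewrite ltrD2l ltr_pM2l // ltr_pM2l ?invr_gt0 // ltrD2r.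
Qed.

Lemma rescale_le x y : (rescale u D u' D' x <= rescale u D u' D' y) = (x <= y).
Proof. by rewrite !leNgt rescale_lt. Qed.

Lemma rescaleK : cancel (rescale u D u' D') (rescale u' D' u D).
Proof.
move=> x; rewrite /rescale [D'.1 + _]addrC addrK mulKf // mulVKf //.
by rewrite addrC subrK.
Qed.

Lemma rescale2K : cancel (rescale2 u D u' D') (rescale2 u' D' u D).
Proof. by case=> a b; rewrite /rescale2 /= !rescaleK. Qed.

Lemma rescale_min : rescale u D u' D' D.1 = D'.1.
Proof. by rewrite /rescale subrr !mulr0 addr0. Qed.

Lemma rescale_max : rescale u D u' D' D.2 = D'.2.
Proof.
have [] := DD'; rewrite /rescale /nlen => -> _.
by rewrite mulVKf // addrC subrK.
Qed.

(** The neighbour of [D'] with the same entry in the neighbour set: [rescale]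
matches the two basic intervals. *)
Lemma rescale_cover y : y \in pts S u -> y <= D.1 -> D.2 <= y + r ^+ size u ->
  exists y', [/\ y' \in pts S u', y' <= D'.1, D'.2 <= y' + r ^+ size u' &
    forall z, rescale u D u' D' (y + r ^+ size u * z) = y' + r ^+ size u' * z].
Proof.
move=> yu y1 y2; have [_ EV] := DD'.
have : r ^- size u * (D.1 - y) \in nset S u D by apply/mem_nset; exists y.
rewrite EV => /mem_nset[y' yu' [y1' y2' e]]; exists y'; split => // z.
rewrite /rescale.
have -> : y + r ^+ size u * z - D.1 = r ^+ size u * z - (D.1 - y) by ring.
by rewrite mulrBr e mulKf // mulrBr mulVKf //; ring.
Qed.

(** An end point inside [D] comes from a basic interval that covers [D]. *)
Lemma endp_transfer k x : x \in endp S (rcons u k) -> D.1 <= x <= D.2 ->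
  rescale u D u' D' x \in endp S (rcons u' k).
Proof.
have [D1 D2 D12 _] := pD; have [D1' D2' _ _] := pD'.
rewrite -!cats1 => xu /andP[]; rewrite le_eqVlt => /orP[/eqP <- _|x1].
  by rewrite rescale_min; exact: endp_sub.
rewrite le_eqVlt => /orP[/eqP ->|x2].
  by rewrite rescale_max; exact: endp_sub.
have xD : D.1 < x < D.2 by rewrite x1.
have [y [z [yu zk xE]]] := (endp_cat S _ _ _).1 xu.
have /andP[z0 z1] := endp_itv hull zk.
have [|y1 y2] := prenet_cover pD yu xD.
  by rewrite xE; have := rX_gt0 (size u) => ?; apply/andP; split; nra.
have [y' [yu' _ _ E]] := rescale_cover yu y1 y2.
by apply/endp_cat; exists y', z; rewrite xE E.
Qed.

Lemma inside_rescale E : inside D E -> inside D' (rescale2 u D u' D' E).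
Proof. by rewrite /inside /= -{1}rescale_min -{1}rescale_max !rescale_le. Qed.

Lemma nset_transfer k E x : prenet S (rcons u k) E -> inside D E ->
  x \in nset S (rcons u k) E -> x \in nset S (rcons u' k) (rescale2 u D u' D' E).
Proof.
move=> [_ _ E12 _] /andP[DE1 DE2] /mem_nset[y yu [y1 y2 xE]].
have [y0 [d [y0u dk yE]]] := (mem_pts_rcons _ _ _ _).1 yu.
have /andP[d0 d1] := digits_itv hull dk; have rn := rX_gt0 (size u).
rewrite size_rcons exprS in y2 xE.
have mid : D.1 < (E.1 + E.2) / 2 < D.2 by apply/andP; split; lra.
have [|z1 z2] := prenet_cover pD y0u mid.
  have := rX_gt0 (size u) => ?; have r0 := r_gt0.
  by rewrite {}yE in y1 y2; apply/andP; split; nra.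
have [y' [yu' _ _ E']] := rescale_cover y0u z1 z2.
have yy : rescale u D u' D' y = y' + r ^+ size u' * d by rewrite yE E'.
apply/mem_nset; exists (y' + r ^+ size u' * d).
  by apply/mem_pts_rcons; exists y', d.
rewrite size_rcons exprS -yy /= !rescale_le; split => //.
  apply: le_trans (_ : rescale u D u' D' (y + r * r ^+ size u) <= _).
    by rewrite rescale_le.
  rewrite (_ : y + _ = y0 + r ^+ size u * (d + r)); last by rewrite yE; ring.
  by rewrite E' yy le_eqVlt; apply/orP; left; apply/eqP; ring.
rewrite xE /rescale; field; first by rewrite !rX_neq0 lt0r_neq0.
Qed.

End Transfer.

Lemma prenet_transfer u u' D D' k E : prenet S u D -> prenet S u' D' ->
  same_type u D u' D' -> prenet S (rcons u k) E -> inside D E ->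
  prenet S (rcons u' k) (rescale2 u D u' D' E).
Proof.
move=> pD pD' DD' pE DE; have [E1 E2 E12 no] := pE.
have [_ _ D12 _] := pD.
have DE' := inside_rescale DD' DE; have {DE}/andP[DE1 DE2] := DE.
split; rewrite /= ?rescale_lt //.
- by apply: endp_transfer => //; rewrite DE1 (le_trans (ltW E12)).
- by apply: endp_transfer => //; rewrite DE2 andbT (le_trans DE1) // ltW.
move=> e eu /andP[e1 e2]; have {DE'}/andP[D1E D2E] := DE'.
apply: (no (rescale u' D' u D e)).
  apply: endp_transfer => //; first exact: same_type_sym.
  by rewrite (le_trans D1E (ltW e1)) (le_trans (ltW e2) D2E).
rewrite -{1}(@rescaleK u u' D D' E.1) -{1}(@rescaleK u u' D D' E.2).
by rewrite !rescale_lt e1.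
Qed.

Lemma same_type_transfer u u' D D' k E : prenet S u D -> prenet S u' D' ->
  same_type u D u' D' -> prenet S (rcons u k) E -> inside D E ->
  same_type (rcons u k) E (rcons u' k) (rescale2 u D u' D' E).
Proof.
move=> pD pD' DD' pE DE; split.
  by rewrite /nlen /rescale2 /rescale /= !size_rcons !exprS; field; rewrite !rX_neq0 lt0r_neq0.
apply: lt_sorted_eq; rewrite ?sort_lt_sorted ?undup_uniq // => x.
apply/idP/idP => [|xE]; first exact: nset_transfer.
rewrite -(@rescale2K u u' D D' E); apply: nset_transfer => //.
- exact: same_type_sym.
- exact: prenet_transfer.
- exact: inside_rescale.
Qed.

Lemma live_transfer u u' D D' w : prenet S u D -> prenet S u' D' ->
  same_type u D u' D' -> live S (catw u w) D -> live S (catw u' w) D'.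
Proof.
move=> pD pD' [e1 e2] /(liveP hull _ pD)[p [z [pu Kz pz]]].
by apply/(liveP hull _ pD'); exists p, z; rewrite -e1 -e2.
Qed.

(** Both intervals see the same tail through the same neighbours. *)
Lemma net_live_transfer w n D E : prenet S (pfx w n) D -> E \in net_intervals S w n ->
  same_type (pfx w n) D (pfx w n) E -> D \in net_intervals S w n.
Proof.
move=> pD /(net_intervalsP hull)[pE lE] DE; apply/(net_intervalsP hull); split => //.
by have := live_transfer (w := tail n w) pE pD (same_type_sym DE); rewrite catw_pfx_tail; exact.
Qed.

Lemma net_childP w n D E : net_child S w n D E <->
  [/\ D \in net_intervals S w n, E \in net_intervals S w n.+1 & inside D E].
Proof.
split=> -[Dn En sub]; split => //; have := En => /(net_intervalsP hull)[[_ _ E12 _] _].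
  apply/andP; split.
    by have := sub E.1; rewrite /cc /= !in_itv /= lexx (ltW E12) => /(_ isT)/andP[].
  by have := sub E.2; rewrite /cc /= !in_itv /= lexx (ltW E12) => /(_ isT)/andP[].
have /andP[h1 h2] := sub.
by move=> x; rewrite /cc /= !in_itv /= => /andP[x1 x2]; rewrite (le_trans h1) // (le_trans x2).
Qed.

Lemma char_vector_eq w n D w' n' D' :
  D \in net_intervals S w n -> D' \in net_intervals S w' n' ->
  char_vector S w n D = char_vector S w' n' D' <->
  same_type (pfx w n) D (pfx w' n') D' /\ sibling_rank S w n D = sibling_rank S w' n' D'.
Proof.
move=> /(net_intervalsP hull)[pD _] /(net_intervalsP hull)[pD' _].
rewrite !char_vectorE //; split; first by case=> e1 e2 e3.
by case=> -[e1 e2] e3; rewrite e1 e2 e3.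
Qed.

(** ** The rank among siblings *)

(** The siblings among which the rank is counted. *)
Definition twins w n E : seq (R * R) :=
  [seq F <- siblings S w n E | (norm_length S n.+1 F == norm_length S n.+1 E)
     && (neighbour_set S w n.+1 F == neighbour_set S w n.+1 E)].

Lemma sibling_rankS w n E : sibling_rank S w n.+1 E = (index E (twins w n E)).+1.
Proof. by []. Qed.

Lemma net_child_unique w n D D' E :
  net_child S w n D E -> net_child S w n D' E -> D = D'.
Proof.
move=> /net_childP[/(net_intervalsP hull)[pD _] /(net_intervalsP hull)[pE _] DE].
move=> /net_childP[/(net_intervalsP hull)[pD' _] _ D'E].
by rewrite pfx_rcons -cats1 in pE; exact: prenet_inside_eq pD pD' pE DE D'E.
Qed.

Lemma mem_twins w n D E F : net_child S w n D E -> F \in twins w n E <->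
  net_child S w n D F /\ same_type (pfx w n.+1) F (pfx w n.+1) E.
Proof.
move=> DE; have /net_childP[_ En _] := DE.
have net12 G : G \in net_intervals S w n.+1 -> G.1 <= G.2.
  by move=> /(net_intervalsP hull)[[_ _ /ltW]].
rewrite 2!mem_filter; split.
  move=> /and3P[/andP[/eqP e1 /eqP e2] /asboolP[D0 [D0E D0F]] Fn].
  rewrite (net_child_unique DE D0E); split => //.
  by rewrite !(norm_lengthE _ w) in e1; rewrite !neighbour_setE ?net12 // in e2; split.
move=> [DF [e1 e2]]; have /net_childP[_ Fn _] := DF; rewrite Fn andbT.
rewrite -!neighbour_setE ?net12 // in e2; rewrite -!(norm_lengthE _ w) in e1.
by rewrite e1 e2 !eqxx /=; apply/asboolP; exists D.
Qed.

Local Notation ltl := (fun D D' : R * R => D.1 < D'.1).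

Lemma ltl_trans : transitive (ltl : rel (R * R)).
Proof. by move=> ? ? ?; exact: lt_trans. Qed.

Lemma ltl_irr : irreflexive (ltl : rel (R * R)).
Proof. by move=> ?; exact: ltxx. Qed.

Lemma twins_sorted w n E : sorted ltl (twins w n E).
Proof.
do 2! [apply: sorted_filter; first exact: ltl_trans].
exact: net_intervals_sorted.
Qed.

(** The rank is the index in a list which all siblings of one type share. *)
Lemma char_vector_inj w n D E F : net_child S w n D E -> net_child S w n D F ->
  char_vector S w n.+1 E = char_vector S w n.+1 F -> E = F.
Proof.
move=> DE DF; have /net_childP[_ En _] := DE; have /net_childP[_ Fn _] := DF.
move=> /(char_vector_eq En Fn)[EF]; rewrite !sibling_rankS => -[].
have -> : twins w n E = twins w n F.
  apply: (irr_sorted_eq ltl_trans ltl_irr (twins_sorted _ _ _) (twins_sorted _ _ _)) => G.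
  apply/idP/idP => [/(mem_twins _ DE)[DG GE]|/(mem_twins _ DF)[DG GF]].
    by apply/(mem_twins _ DF); split => //; exact: same_type_trans GE EF.
  apply/(mem_twins _ DE); split => //.
  exact: same_type_trans GF (same_type_sym EF).
have Ein : E \in twins w n F by apply/(mem_twins _ DF); split.
have Fin : F \in twins w n F by apply/(mem_twins _ DF); split.
by move=> EFi; rewrite -(nth_index E Ein) EFi nth_index.
Qed.

Section Rank.
Variables (w w' : nat -> letter) (n n' : nat) (D D' E : R * R).
Local Notation u := (pfx w n).
Local Notation u' := (pfx w' n').
Local Notation phi := (rescale2 u D u' D').
Hypotheses (ww' : w n = w' n') (DD' : same_type u D u' D').
Hypotheses (DE : net_child S w n D E) (DE' : net_child S w' n' D' (phi E)).

Lemma twins_transfer F : F \in twins w n E -> phi F \in twins w' n' (phi E).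
Proof.
have /net_childP[Dn En insE] := DE; have /net_childP[Dn' En' _] := DE'.
have [pD _] := (net_intervalsP hull _ _ _).1 Dn.
have [pD' _] := (net_intervalsP hull _ _ _).1 Dn'.
have [pE _] := (net_intervalsP hull _ _ _).1 En.
move=> /(mem_twins _ DE)[/net_childP[_ Fn insF] FE].
have [pF _] := (net_intervalsP hull _ _ _).1 Fn.
have type G : prenet S (pfx w n.+1) G -> inside D G ->
    prenet S (pfx w' n'.+1) (phi G) /\ same_type (pfx w n.+1) G (pfx w' n'.+1) (phi G).
  rewrite !pfx_rcons -ww' => pG insG.
  by split; [exact: prenet_transfer|exact: same_type_transfer].
have [pF' FF'] := type _ pF insF; have [pE' EE'] := type _ pE insE.
have FE' : same_type (pfx w' n'.+1) (phi F) (pfx w' n'.+1) (phi E).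
  exact: same_type_trans (same_type_sym FF') (same_type_trans FE EE').
apply/(mem_twins _ DE'); split; last exact: FE'.
apply/net_childP; split; first exact: Dn'.
  exact: net_live_transfer pF' En' FE'.
exact: inside_rescale.
Qed.

End Rank.

(** The rank only counts siblings of the same type, and these are all net
intervals as soon as one of them is; so it is read off the parent's type. *)
Lemma sibling_rank_transfer w w' n n' D D' E :
  w n = w' n' -> same_type (pfx w n) D (pfx w' n') D' ->
  net_child S w n D E -> net_child S w' n' D' (rescale2 (pfx w n) D (pfx w' n') D' E) ->
  sibling_rank S w n.+1 E =
  sibling_rank S w' n'.+1 (rescale2 (pfx w n) D (pfx w' n') D' E).
Proof.
move=> ww' DD' DE DE'; rewrite !sibling_rankS; congr _.+1.
set phi := rescale2 _ _ _ _.
have phi_inj : injective phi by apply: can_inj; exact: rescale2K.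
suff -> : twins w' n' (phi E) = map phi (twins w n E) by rewrite index_map.
apply: (irr_sorted_eq ltl_trans ltl_irr (twins_sorted _ _ _)).
  apply: homo_sorted (twins_sorted w n E) => F G.
  by rewrite /phi /= rescale_lt.
move=> F; apply/idP/mapP => [Ftw|[G Gtw ->]]; last exact: twins_transfer.
exists (rescale2 (pfx w' n') D' (pfx w n) D F); last by rewrite /phi rescale2K.
have := twins_transfer (esym ww') (same_type_sym DD') DE' _ Ftw.
by rewrite /phi rescale2K; exact.
Qed.

End Types.

(** * The adjacency matrices count net intervals *)

Section Matrices.
Variables (R : realType) (m : nat) (S : rifs R m).
Local Notation r := (rifs_ratio S).
Local Notation letter := 'I_m.+1.
Implicit Types (u v : seq letter) (w : nat -> letter) (x y z p : R) (D E : R * R).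
Hypothesis hull : forall w, conv_hull (attractor S w) = [set` `[0, 1]].
Variables (N : nat) (gamma : 'I_N -> charvec R).
Hypothesis gamma_inj : injective gamma.

Let r_gt0 : 0 < r. Proof. exact: ratio_gt0. Qed.
Let r_lt1 : r < 1. Proof. exact: ratio_lt1. Qed.
Let rX_gt0 n : 0 < r ^+ n. Proof. exact: ratioX_gt0. Qed.
Let rX_neq0 n : r ^+ n != 0. Proof. exact/lt0r_neq0/ratioX_gt0. Qed.
Hint Resolve r_gt0 r_lt1 rX_gt0 rX_neq0 : core.

Local Notation A := (adjacency S gamma).

Definition mprod v : 'M[R]_N := \big[mulmx/1%:M]_(k <- v) A k.
Definition rowsum v i : R := \sum_j mprod v i j.

Lemma mprod_pfx w n : \big[mulmx/1%:M]_(i < n) A (w i) = mprod (pfx w n).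
Proof.
by rewrite /mprod /pfx /mkseq big_map -(big_mkord xpredT (fun i => A (w i))) /index_iota subn0.
Qed.

Lemma mprod_cons k v : mprod (k :: v) = A k *m mprod v.
Proof. by rewrite /mprod big_cons. Qed.

Lemma mprod_cat u v : mprod (u ++ v) = mprod u *m mprod v.
Proof.
elim: u => [|k u IH]; first by rewrite [mprod [::]]/mprod big_nil mul1mx.
by rewrite cat_cons !mprod_cons IH mulmxA.
Qed.

Lemma adjacency_ge0 k i j : 0 <= A k i j.
Proof. by rewrite mxE ler0n. Qed.

Lemma mprod_ge0 v i j : 0 <= mprod v i j.
Proof.
elim: v i j => [|k v IH] i j; first by rewrite /mprod big_nil mxE ler0n.
by rewrite mprod_cons mxE sumr_ge0 // => l _; rewrite mulr_ge0 ?adjacency_ge0.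
Qed.

Lemma rowsum_ge0 v i : 0 <= rowsum v i.
Proof. by apply: sumr_ge0 => j _; exact: mprod_ge0. Qed.

Lemma rowsum_nil i : rowsum [::] i = 1.
Proof.
rewrite /rowsum /mprod big_nil (bigD1 i) //= mxE eqxx big1 ?addr0 // => j ji.
by rewrite mxE eq_sym (negbTE ji).
Qed.

Lemma rowsum_cat u v i : rowsum (u ++ v) i = \sum_j mprod u i j * rowsum v j.
Proof.
rewrite /rowsum mprod_cat; under eq_bigr do rewrite mxE.
by rewrite exchange_big; apply: eq_bigr => j _; rewrite mulr_sumr.
Qed.

Lemma rowsum_cons k v i : rowsum (k :: v) i =
  \sum_(j | `[< cv_child_under S k (gamma i) (gamma j) >]) rowsum v j.
Proof.
rewrite -cat1s rowsum_cat [RHS]big_mkcond; apply: eq_bigr => j _.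
rewrite mprod_cons {1}/mprod big_nil mulmx1 mxE; case: ifP => _; by rewrite ?mul1r ?mul0r.
Qed.

Lemma mx_sum_normE v : mx_sum_norm (mprod v) = \sum_i rowsum v i.
Proof. by apply: eq_bigr => i _; apply: eq_bigr => j _; rewrite ger0_norm ?mprod_ge0. Qed.

Lemma mx_sum_norm_ge0 v : 0 <= mx_sum_norm (mprod v).
Proof. by rewrite mx_sum_normE sumr_ge0 // => i _; exact: rowsum_ge0. Qed.

Lemma rowsum_cat_le u v i :
  rowsum (u ++ v) i <= mx_sum_norm (mprod u) * mx_sum_norm (mprod v).
Proof.
rewrite rowsum_cat; apply: le_trans (_ : \sum_j mprod u i j * mx_sum_norm (mprod v) <= _).
  apply: ler_sum => j _; rewrite ler_wpM2l ?mprod_ge0 // mx_sum_normE (bigD1 j) //=.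
  by rewrite lerDl sumr_ge0 // => l _; exact: rowsum_ge0.
rewrite -mulr_suml ler_wpM2r ?mx_sum_norm_ge0 // mx_sum_normE [leRHS](bigD1 i) //=.
by rewrite lerDl sumr_ge0 // => l _; exact: rowsum_ge0.
Qed.

Lemma cv_child_underP j (a b : charvec R) : cv_child_under S j a b <->
  exists w n D E, [/\ net_child S w n D E, w n = j,
    char_vector S w n D = a & char_vector S w n.+1 E = b].
Proof.
split.
  move=> [g [[w [n [D [wj Dg child]]]] [<- <-]]].
  exists w, n, (D ord0), (D ord_max); split.
  - have := child ord0; rewrite addn0.
    by congr (net_child _ _ _ (D _) (D _)); apply: val_inj.
  - by have := wj ord0; rewrite addn0.
  - by have [_] := Dg ord0; rewrite addn0.
  - by have [_] := Dg ord_max; rewrite /= addn1.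
move=> [w [n [D [E [DE wj Da Eb]]]]].
have [Dn En _] := DE.
exists (fun i : 'I_2 => if i == ord0 then a else b); split; last by [].
exists w, n, (fun i : 'I_2 => if i == ord0 then D else E); split.
- by move=> i; rewrite ord1 addn0.
- by case=> -[|[|//]] il /=; rewrite ?addn0 ?addn1.
- by move=> i; rewrite ord1 addn0.
Qed.

Lemma cv_child_under_child j (a b : charvec R) :
  cv_child_under S j a b -> cv_child S a b.
Proof. by move=> [g [h l]]; exists g; split => //; exists (fun=> j). Qed.

(** ** Every path of the matrix product is realised below a given interval *)

Definition prenets u := zip (sort <=%R (undup (endp S u)))
  (behead (sort <=%R (undup (endp S u)))).

Lemma mem_prenets u D : D \in prenets u <-> prenet S u D.
Proof.
rewrite zip_beheadP; last by rewrite sort_lt_sorted undup_uniq.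
by apply: consecutive_eq => x; rewrite mem_sort mem_undup.
Qed.

Lemma size_prenets u : (size (prenets u) <= 2 * npts S u)%N.
Proof.
rewrite size_zip; apply: leq_trans (geq_minl _ _) _.
rewrite size_sort; apply: leq_trans (size_undup _) _.
by rewrite size_cat size_map mul2n addnn.
Qed.

Lemma rescale_comp u D u' D' u'' D'' x :
  rescale S u' D' u'' D'' (rescale S u D u' D' x) = rescale S u D u'' D'' x.
Proof.
by rewrite /rescale [D'.1 + _]addrC addrK mulKf.
Qed.

Lemma char_vector_rank w n D : (char_vector S w n D).2 = sibling_rank S w n D.
Proof. by []. Qed.

(** A child that occurs somewhere below an interval of the type of [gamma i] is
carried to [D] by [rescale2]. The images are counted among all intervals between
consecutive end points, alive or not. Children with different vectors have
different images, because the position inside the parent determines the vector,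
including the rank. *)
Lemma rowsum_le_count v u D i : prenet S u D ->
  (nlen S u D, nset S u D) = (gamma i).1 ->
  rowsum v i <= (count (inside D) (prenets (u ++ v)))%:R.
Proof.
elim: v u D i => [|k v IH] u D i pD typeD.
  rewrite rowsum_nil cats0 ler1n -has_count; apply/hasP; exists D; first exact/mem_prenets.
  by rewrite /inside !lexx.
rewrite rowsum_cons -cat_rcons.
pose good (i' : 'I_N) (X : R * R) := cv_child_under S k (gamma i) (gamma i') ->
  [/\ prenet S (rcons u k) X, inside D X,
      (nlen S (rcons u k) X, nset S (rcons u k) X) = (gamma i').1 &
  exists w n D0 E0, [/\ net_child S w n D0 E0, w n = k, char_vector S w n D0 = gamma i,
     char_vector S w n.+1 E0 = gamma i' & X = rescale2 S (pfx w n) D0 u D E0]].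
have /choice[X XP] : forall i', exists X, good i' X.
  move=> i'; have [child|] := pselect (cv_child_under S k (gamma i) (gamma i')); last first.
    by exists (0, 0).
  have /cv_child_underP[w [n [D0 [E0 [DE wk D0i E0i]]]]] := child.
  exists (rescale2 S (pfx w n) D0 u D E0) => _.
  have /net_childP[//|/(net_intervalsP hull)[pD0 _] /(net_intervalsP hull)[pE0 _] ins] := DE.
  have st : same_type S (pfx w n) D0 u D.
    by move: typeD; rewrite -D0i char_vectorE // => -[? ?]; split.
  rewrite pfx_rcons wk in pE0.
  split.
  - exact: prenet_transfer.
  - exact: inside_rescale.
  - have [<- <-] := same_type_transfer hull pD0 pD st pE0 ins.
    by rewrite -E0i char_vectorE pfx_rcons wk.
  - by exists w, n, D0, E0.
apply: le_trans (_ : \sum_(j | `[< cv_child_under S k (gamma i) (gamma j) >])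
    (count (inside (X j)) (prenets (rcons u k ++ v)))%:R <= _).
  by apply: ler_sum => j /asboolP/XP[pX _ tX _]; exact: IH.
rewrite -natr_sum ler_nat; apply: sum_count_le.
  by move=> j E /asboolP/XP[_ DX _ _]; exact: inside_trans.
move=> E j j' /mem_prenets pE /asboolP/XP[pX _ tX [w [n [D0 [E0 [c1 c2 c3 c4 c5]]]]]].
move=> /asboolP/XP[pX' _ tX' [w' [n' [D0' [E0' [c1' c2' c3' c4' c5']]]]]] XE XE'.
have XX := prenet_inside_eq pX pX' pE XE XE'.
apply: gamma_inj.
(* Both children are images of one interval, so they correspond to each other. *)
have E0E : E0' = rescale2 S (pfx w n) D0 (pfx w' n') D0' E0.
  rewrite -(@rescale2K _ _ S (pfx w' n') u D0' D E0') -c5' -XX c5.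
  by rewrite /rescale2 /= !rescale_comp.
have /net_childP[//|D0n E0n _] := c1; have /net_childP[//|D0n' E0n' _] := c1'.
have [st _] := (char_vector_eq hull D0n D0n').1 (etrans c3 (esym c3')).
have tt : (gamma j).1 = (gamma j').1 by rewrite -tX -tX' XX.
have rank_j : (gamma j).2 = sibling_rank S w n.+1 E0.
  rewrite -c4; exact: char_vector_rank.
have rank_j' : (gamma j').2 = sibling_rank S w' n'.+1 E0'.
  rewrite -c4'; exact: char_vector_rank.
have : (gamma j).2 = (gamma j').2.
  rewrite rank_j rank_j' E0E; apply: sibling_rank_transfer; last by rewrite -E0E.
  - exact: hull.
  - by rewrite c2.
  - exact: st.
  - exact: c1.
by move: tt; case: (gamma j) (gamma j') => ? ? [? ?] /= -> ->.
Qed.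

(** ** Every net interval below an essential one comes from a path *)

Section Lower.
Hypothesis closed_gamma : forall i b, cv_child S (gamma i) b -> exists j, gamma j = b.

(** The child of [D] that contains a given net interval is the first step of its
path. It lies in the class, which is closed, and siblings are told apart by
their characteristic vectors. *)
Lemma count_le_rowsum w n k D i :
  D \in net_intervals S w n -> char_vector S w n D = gamma i ->
  (count (inside D) (net_intervals S w (n + k)))%:R <= rowsum (pfx (tail n w) k) i.
Proof.
elim: k n D i => [|k IH] n D i Dn Di.
  rewrite rowsum_nil addn0 lern1.
  apply: leq_trans (_ : count_mem D (net_intervals S w n) <= _)%N.
    rewrite -!size_filter; apply: uniq_leq_size; first exact/filter_uniq/net_intervals_uniq.
    move=> E; rewrite !mem_filter => /andP[DE En]; rewrite En andbT /= eq_sym.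
    have pD := ((net_intervalsP hull _ _ _).1 Dn).1.
    have pE := ((net_intervalsP hull _ _ _).1 En).1.
    apply/eqP; apply: (prenet_inside_eq (v := [::]) pD pE _ DE); first by rewrite cats0.
    by rewrite /inside !lexx.
  by rewrite count_uniq_mem ?net_intervals_uniq // leq_b1.
rewrite pfxS tail_tail addn1 [tail n w 0]/tail addn0 rowsum_cons addnS -addSn.
set L := net_intervals S w (n.+1 + k).
pose J := [seq E <- net_intervals S w n.+1 | inside D E].
have JP E : E \in J -> net_child S w n D E.
  by rewrite mem_filter => /andP[DE En]; apply/net_childP.
have under E : net_child S w n D E ->
    cv_child_under S (w n) (gamma i) (char_vector S w n.+1 E).
  by move=> DE; apply/cv_child_underP; exists w, n, D, E.
have /choice[idx idxP] : forall E, exists j, E \in J -> gamma j = char_vector S w n.+1 E.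
  move=> E; case EJ : (E \in J); last by exists i.
  have [j jE] := closed_gamma (cv_child_under_child (under _ (JP _ EJ))).
  by exists j.
have idx_inj : {in J &, injective idx}.
  move=> E F EJ FJ EF; apply: (char_vector_inj hull (JP _ EJ) (JP _ FJ)).
  by rewrite -!idxP // EF.
apply: le_trans (_ : (\sum_(E <- J) count (inside E) L)%:R <= _).
  rewrite ler_nat; apply: count_le_sum => F FL DF.
  have [pF lF] := (net_intervalsP hull _ _ _).1 FL.
  rewrite pfxD in pF; have [E pE EF] := prenet_parent hull pF.
  exists E => //; rewrite mem_filter; apply/andP; split.
    have pD := ((net_intervalsP hull _ _ _).1 Dn).1.
    move: pE pF; rewrite pfx_rcons -cats1 => pE pF.
    exact: (prenet_nested hull pE pD pF EF DF).
  by apply/(net_intervalsP hull); split => //; exact: live_inside EF lF.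
rewrite natr_sum.
apply: le_trans (_ : \sum_(E <- J) rowsum (pfx (tail n.+1 w) k) (idx E) <= _).
  rewrite big_seq [leRHS]big_seq; apply: ler_sum => E EJ; apply: IH.
    by have /net_childP[] := JP _ EJ.
  by rewrite idxP.
rewrite -(big_map idx xpredT (fun j => rowsum (pfx (tail n.+1 w) k) j)).
rewrite big_uniq /=; last by rewrite map_inj_in_uniq // filter_uniq // net_intervals_uniq.
rewrite big_mkcond [leRHS]big_mkcond; apply: ler_sum => j _.
case: ifP => [/mapP[E EJ ->]|_]; last by case: ifP => // _; exact: rowsum_ge0.
by case: asboolP => //; rewrite idxP // => no; case: no; exact/under/JP.
Qed.

(** To the right of each point of the deeper level there is an interval that is
alive, since every attractor accumulates at 0 from the right. *)
Lemma npts_le_count w n k y : y \in pts S (pfx w n) ->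
  (npts S (pfx (tail n w) k) <=
    count (inside (y, (y + r ^+ n)%R)) (net_intervals S w (n + k)))%N.
Proof.
move=> yp; set L := net_intervals _ _ _.
rewrite /npts -(size_map (fun z => y + r ^+ n * z)) -size_filter -(size_map fst).
apply: uniq_leq_size.
  rewrite map_inj_uniq ?pts_uniq // => a b /addrI; exact/mulfI.
move=> _ /mapP[z zp ->]; set x := y + _.
have xp : x \in pts S (pfx w (n + k)).
  by rewrite pfxD; apply/mem_pts_cat; exists y, z; rewrite size_pfx.
have rnk := rX_gt0 (n + k).
have [||b] := @min_ge_mem R [seq e <- endp S (pfx w (n + k)) | x < e] x (x + r ^+ (n + k)).
- rewrite mem_filter ltrDl rnk /=.
  by have := pts_endp1 xp; rewrite size_pfx.
- by rewrite lerDl ltW.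
rewrite mem_filter => -[/andP[xb bp] _ bmin].
have brn : b <= y + r ^+ n.
  apply: le_trans (bmin (x + r ^+ (n + k)) _ _) _.
  - by rewrite mem_filter ltrDl rnk /=; have := pts_endp1 xp; rewrite size_pfx.
  - by rewrite lerDl ltW.
  have /andP[_] := pts_itv hull zp; rewrite size_pfx => z1.
  rewrite /x exprD -addrA lerD2l -mulrDr ler_piMr ?(ltW (rX_gt0 _)) //; lra.
apply/mapP; exists (x, b) => //; rewrite mem_filter; apply/andP; split.
  rewrite /inside /= brn andbT lerDl mulr_ge0 ?(ltW (rX_gt0 _)) //.
  by have /andP[] := pts_itv hull zp.
apply/(net_intervalsP hull); split.
  split => //=; first exact: pts_endp.
  move=> e ep /andP[xe eb]; move: eb; rewrite ltNge bmin //; last exact: ltW.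
  by rewrite mem_filter xe.
have xb0 : 0 < b - x by rewrite subr_gt0.
have [q qb] := ratioX_small S xb0.
exists (x + r ^+ (n + k) * r ^+ q).
  rewrite -(catw_pfx_tail w (n + k)); apply/(attractor_cat hull).
  by exists x, (r ^+ q); rewrite size_pfx; split => //; exact: attractorX.
rewrite /= ltrDl mulr_gt0 //= -ltrBrDl; apply: le_lt_trans qb.
by rewrite ler_piMl ?ratioX_le1 // ltW.
Qed.

(** Length and neighbour set only see the prefix, and so does the rank, by
[sibling_rank_transfer]. *)
Lemma char_vector_tail w w' n D : pfx w n = pfx w' n ->
  D \in net_intervals S w n -> D \in net_intervals S w' n ->
  char_vector S w n D = char_vector S w' n D.
Proof.
move=> ww' Dn Dn'; apply/(char_vector_eq hull Dn Dn').
split; first by rewrite ww'.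
case: n ww' Dn Dn' => [//|n] ww' Dn Dn'.
have [pD lD] := (net_intervalsP hull _ _ _).1 Dn.
have [_ lD'] := (net_intervalsP hull _ _ _).1 Dn'.
move: ww'; rewrite !pfx_rcons => /rcons_inj[ww' wn].
rewrite pfx_rcons -cats1 in pD.
have [E pE ED] := prenet_parent hull pD.
have En : E \in net_intervals S w n.
  by apply/(net_intervalsP hull); split => //; exact: live_inside ED lD.
have En' : E \in net_intervals S w' n.
  by apply/(net_intervalsP hull); rewrite -ww'; split => //; exact: live_inside ED lD'.
have id2 : rescale2 S (pfx w n) E (pfx w' n) E D = D.
  by rewrite -ww' /rescale2 /rescale !mulVKf // ![E.1 + _]addrC !subrK -surjective_pairing.
rewrite -[in RHS]id2; apply: (sibling_rank_transfer hull wn).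
- by rewrite ww'.
- by apply/(net_childP hull); split; [exact: En|exact: Dn|exact: ED].
- by rewrite id2; apply/(net_childP hull); split; [exact: En'|exact: Dn'|exact: ED].
Qed.

(** Fix a basic interval inside the interior of an essential net interval and put
[w] after its word. The outer interval is alive whatever [w] is, and it contains
a net interval for each point of [w]; the letters between the two intervals only
cost the norm of a fixed product. *)
Lemma npts_le_norm w0 n0 D0 i0 : D0 \in net_intervals S w0 n0 ->
  char_vector S w0 n0 D0 = gamma i0 ->
  exists2 C : R, 0 < C & forall w k,
    (npts S (pfx w k))%:R <= C * mx_sum_norm (mprod (pfx w k)).
Proof.
move=> D0n D0i; have [pD0 [x Kx /andP[x1 x2]]] := (net_intervalsP hull _ _ _).1 D0n.
have e0 : 0 < Num.min (x - D0.1) (D0.2 - x) by rewrite lt_min !subr_gt0 x1.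
have [p] := ratioX_small S e0; rewrite lt_min => /andP[p1 p2].
pose M := (n0 + p)%N.
have rM : r ^+ M <= r ^+ p by rewrite exprD ler_piMl ?ratioX_le1 ?(ltW (rX_gt0 _)).
move: Kx; rewrite -{1}(catw_pfx_tail w0 M) => /(attractor_cat hull)[y [z [yp Kz xE]]].
have /andP[z0 z1] := attractor_itv hull Kz; rewrite size_pfx in xE.
have y1 : D0.1 < y by move: (r ^+ M) (rX_gt0 M) rM xE p1 => b b0; move: (r ^+ p) => b' *; nra.
have y2 : y + r ^+ M < D0.2.
  by move: (r ^+ M) (rX_gt0 M) rM xE p2 => b b0; move: (r ^+ p) => b' *; nra.
pose up := pfx (tail n0 w0) p.
exists (mx_sum_norm (mprod up) + 1) => [|w k]; first by rewrite ltr_wpDl ?mx_sum_norm_ge0.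
pose W := catw (pfx w0 M) w.
have WE : W = catw (pfx w0 n0) (catw up w) by rewrite /W /M pfxD catw_cat.
have WM : pfx W M = pfx w0 M by have := pfx_catw_size (pfx w0 M) w; rewrite size_pfx.
have Wn0 : pfx W n0 = pfx w0 n0.
  by have := pfx_catw_size (pfx w0 n0) (catw up w); rewrite size_pfx -WE.
have Wtail : tail M W = w by rewrite -(size_pfx w0 M) tail_catw_size.
have D0W : D0 \in net_intervals S W n0.
  apply/(net_intervalsP hull); rewrite Wn0; split => //.
  exists y; first exact: pts_attractor.
  by rewrite y1 (lt_trans _ y2) // ltrDl.
have D0Wi : char_vector S W n0 D0 = gamma i0 by rewrite -D0i; exact: char_vector_tail.
have := count_le_rowsum (p + k) D0W D0Wi.
have -> : pfx (tail n0 W) (p + k) = up ++ pfx w k.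
  by rewrite WE -{1}(size_pfx w0 n0) tail_catw_size -(size_pfx (tail n0 w0) p) pfx_catw.
move=> /le_trans-/(_ _ (rowsum_cat_le _ _ _)) h.
apply: le_trans (_ : mx_sum_norm (mprod up) * mx_sum_norm (mprod (pfx w k)) <= _); last first.
  by rewrite ler_wpM2r ?mx_sum_norm_ge0 // lerDl.
apply: le_trans h; rewrite ler_nat -{1}Wtail addnA -/M.
apply: leq_trans (npts_le_count k (y := y) _) _; first by rewrite WM.
apply: sub_count => F /andP[/= F1 F2]; apply/andP; split.
  exact: le_trans (ltW y1) F1.
exact: le_trans F2 (ltW y2).
Qed.

End Lower.

(** Each index occurs as the vector of some net interval, and these finitely many
choices give the constant. *)
Lemma norm_le_npts : range gamma `<=` char_vectors S ->
  exists2 C : R, 0 < C & forall v, mx_sum_norm (mprod v) <= C * (npts S v)%:R.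
Proof.
move=> cv.
have /choice[C CP] : forall i, exists C : R,
    0 <= C /\ forall v, rowsum v i <= C * (npts S v)%:R.
  move=> i; have [|w [n [D [Dn Di]]]] := cv (gamma i); first by exists i.
  have [pD _] := (net_intervalsP hull _ _ _).1 Dn.
  exists (2 * (npts S (pfx w n))%:R); split => // v.
  apply: le_trans (rowsum_le_count v pD _) _; first by rewrite Di char_vectorE.
  rewrite -!natrM ler_nat; apply: leq_trans (count_size _ _) _.
  apply: leq_trans (size_prenets _) _; rewrite -mulnA leq_mul2l npts_cat_le //.
exists (\sum_i C i + 1) => [|v].
  by rewrite ltr_wpDl // sumr_ge0 // => i _; have [] := CP i.
rewrite mx_sum_normE mulrDl ler_wpDr // mulr_suml; apply: ler_sum => i _.
by have [_] := CP i.
Qed.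

End Matrices.

(** * Almost additive functions of a Bernoulli sequence *)

Section Bernoulli.
Variables (R : realType) (m : nat) (theta : 'I_m.+1 -> R).
Hypothesis theta_gt0 : forall j, 0 < theta j.
Hypothesis theta_sum1 : \sum_j theta j = 1.
Local Notation letter := 'I_m.+1.
Implicit Types (u v : seq letter) (f g : seq letter -> R).

(** The expectation of [f] over words of length [n] with independent letters of
law [theta]. The recursion on the first letter makes [mean_cat] immediate. *)
Fixpoint mean n f : R :=
  if n is n'.+1 then \sum_a theta a * mean n' (fun u => f (a :: u)) else f [::].

Lemma mean_le n f g : (forall u, size u = n -> f u <= g u) -> mean n f <= mean n g.
Proof.
elim: n f g => [|n IH] f g fg /=; first exact: fg.
apply: ler_sum => a _; rewrite ler_wpM2l ?(ltW (theta_gt0 a)) //.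
by apply: IH => u su; apply: fg; rewrite /= su.
Qed.

Lemma eq_mean n f g : (forall u, size u = n -> f u = g u) -> mean n f = mean n g.
Proof.
by move=> fg; apply/eqP; rewrite eq_le; apply/andP; split; apply: mean_le => u /fg->.
Qed.

Lemma mean_cst n (c : R) : mean n (fun=> c) = c.
Proof.
elim: n => [//|n IH] /=.
rewrite (eq_bigr (fun a => theta a * c)) => [|a _]; last by rewrite IH.
by rewrite -mulr_suml theta_sum1 mul1r.
Qed.

Lemma meanD n f g : mean n (fun u => f u + g u) = mean n f + mean n g.
Proof.
elim: n f g => [//|n IH] f g /=; rewrite -big_split; apply: eq_bigr => a _ /=.
by rewrite IH mulrDr.
Qed.

Lemma meanZ n (c : R) f : mean n (fun u => c * f u) = c * mean n f.
Proof.
elim: n f => [//|n IH] f /=; rewrite mulr_sumr; apply: eq_bigr => a _.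
by rewrite IH mulrCA.
Qed.

Lemma mean_cat n k f : mean (n + k) f = mean n (fun u => mean k (fun v => f (u ++ v))).
Proof.
by elim: n f => [//|n IH] f /=; apply: eq_bigr => a _; rewrite IH.
Qed.

(** ** Exponential moments *)

(** From exp(-x) >= 1 - x, and 1 <= (1 - x) (1 + x + 2 x^2) for x <= 1/2. *)
Lemma expR_le_quad (x : R) : x <= 1 / 2 -> expR x <= 1 + x + 2 * x ^+ 2.
Proof.
move=> x2; have h : 0 < 1 - x by lra.
have := expR_ge1Dx (- x); rewrite expRN => e.
have ex0 := expR_gt0 x.
apply: le_trans (_ : (1 - x)^-1 <= _); first by rewrite -[leLHS]invrK lef_pV2 ?posrE ?invr_gt0.
rewrite -[leLHS]mul1r ler_pdivrMr //.
have x20 := sqr_ge0 x; have : 0 <= x ^+ 2 * (1 - 2 * x) by rewrite mulr_ge0 //; lra.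
lra.
Qed.

Lemma mean_exp_le k f (b s : R) : 0 < b -> 0 <= s -> s * b <= 1 / 2 ->
  (forall u, size u = k -> `|f u| <= b) ->
  mean k (fun u => expR (s * f u)) <= expR (s * mean k f + 2 * (s * b) ^+ 2).
Proof.
move=> b0 s0 sb fb; apply: le_trans (expR_ge1Dx _).
have -> : 1 + (s * mean k f + 2 * (s * b) ^+ 2) =
    mean k (fun u => 1 + s * f u + 2 * (s * b) ^+ 2).
  by rewrite !meanD meanZ !mean_cst addrA.
apply: mean_le => u /fb; rewrite ler_norml => /andP[f1 f2].
have sf1 : - (s * b) <= s * f u by rewrite -mulrN ler_wpM2l.
have sf2 : s * f u <= s * b by rewrite ler_wpM2l.
apply: le_trans (expR_le_quad (le_trans sf2 sb)) _; rewrite lerD2l ler_wpM2l //.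
by move: (s * f u) (s * b) sf1 sf2 => x y h1 h2; nra.
Qed.

Section Subadditive.
Variables (f : seq letter -> R).
Hypothesis f_sub : forall u v, f (u ++ v) <= f u + f v.

(** Blocks are independent and [f] is subadditive, so exponential moments are
submultiplicative. *)
Lemma mean_exp_iter k q (s M : R) : 0 <= s ->
  mean k (fun u => expR (s * f u)) <= M ->
  mean (q * k) (fun u => expR (s * f u)) <= expR (s * f [::]) * M ^+ q.
Proof.
move=> s0 hM; have M0 : 0 <= M.
  apply: le_trans hM; rewrite -(mean_cst k 0); apply: mean_le => u _; exact: expR_ge0.
elim: q => [|q IH]; first by rewrite mul0n /= expr0 mulr1.
rewrite mulSn mean_cat exprS mulrCA.
apply: le_trans (_ : mean k (fun u => (expR (s * f [::]) * M ^+ q) * expR (s * f u)) <= _).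
  apply: mean_le => u _; rewrite mulrC.
  apply: le_trans (_ : mean (q * k) (fun v => expR (s * f u) * expR (s * f v)) <= _).
    by apply: mean_le => v _; rewrite -expRD ler_expR -mulrDr ler_wpM2l.
  by rewrite meanZ ler_wpM2l ?expR_ge0.
by rewrite meanZ mulrC ler_wpM2r // mulr_ge0 ?expR_ge0 ?exprn_ge0.
Qed.

(** Markov's inequality for exp(s f). *)
Lemma chernoff k q (b s e : R) : 0 < b -> 0 <= s -> s * b <= 1 / 2 ->
  (forall u, size u = k -> `|f u| <= b) ->
  mean (q * k) (fun u => (q%:R * (mean k f + e) < f u)%R%:R) <=
    expR (s * f [::]) * expR (2 * (s * b) ^+ 2 - s * e) ^+ q.
Proof.
move=> b0 s0 sb fb; set c := q%:R * (mean k f + e).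
apply: le_trans (_ : mean (q * k) (fun u => expR (- (s * c)) * expR (s * f u)) <= _).
  apply: mean_le => u _; rewrite -expRD.
  case: ltP => cf; last exact: expR_ge0.
  by rewrite -expR0 ler_expR addrC subr_ge0 ler_wpM2l // ltW.
rewrite meanZ; have := mean_exp_iter q s0 (mean_exp_le b0 s0 sb fb).
move=> /(ler_wpM2l (expR_ge0 (- (s * c)))) /le_trans; apply.
rewrite mulrCA ler_wpM2l ?expR_ge0 // -!expRM_natl -expRD ler_expR /c.
by rewrite le_eqVlt; apply/orP; left; apply/eqP; ring.
Qed.

End Subadditive.

(** ** Probability of the events of a finite prefix *)

Variable P : probability (Omega m) R.
Hypothesis P_bernoulli : is_bernoulli theta P.

(** The recursion of [mean] consumes letters from the left, so the induction needs
an arbitrary word [v] already read. *)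
Definition wordset v n (Q : pred (seq letter)) : set (Omega m) :=
  [set w | pfx (w : nat -> letter) (size v) = v /\ Q (pfx (w : nat -> letter) (size v + n))].

Lemma wordset0 v Q : wordset v 0 Q =
  if Q v then cylinder (fun i : 'I_(size v) => nth ord0 v i) else set0.
Proof.
apply/seteqP; rewrite /wordset; split=> w /=.
  rewrite addn0 => -[wv]; rewrite wv => -> i.
  have <- : nth ord0 (pfx (w : nat -> letter) (size v)) i = w i by exact: nth_mkseq.
  by rewrite wv.
case: ifP => [Qv h|//]; rewrite addn0.
suff -> : pfx (w : nat -> letter) (size v) = v by [].
apply: (@eq_from_nth _ ord0); rewrite size_pfx // => i iv.
by rewrite nth_mkseq // (h (Ordinal iv)).
Qed.

Lemma wordsetS v n Q : wordset v n.+1 Q =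
  \big[setU/set0]_(a <- enum letter) wordset (rcons v a) n Q.
Proof.
rewrite -bigcup_seq; apply/seteqP; split=> w.
  move=> [wv Qw]; exists (w (size v)); first by rewrite /= mem_enum.
  rewrite /wordset /= size_rcons addSnnS; split => //.
  by rewrite pfx_rcons wv.
move=> [a _]; rewrite /wordset /= size_rcons addSnnS => -[wv Qw]; split => //.
by move: wv; rewrite pfx_rcons => /rcons_inj[].
Qed.

Lemma wordset_bound v n Q : measurable (wordset v n Q) /\
  (P (wordset v n Q) <=
    ((\prod_(a <- v) theta a) * mean n (fun u => (Q (v ++ u))%:R))%:E)%E.
Proof.
elim: n v => [|n IH] v.
  rewrite wordset0 /= cats0; case: ifP => _; last first.
    by rewrite measure0 mulr0; split.
  split.
    by apply: sub_sigma_algebra; exists (size v), (fun i : 'I_(size v) => nth ord0 v i).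
  by rewrite P_bernoulli mulr1 (big_nth ord0) big_mkord.
rewrite wordsetS; split; first by apply: bigsetU_measurable => a _; have [] := IH (rcons v a).
apply: le_trans (_ : (\sum_(a <- enum letter) P (wordset (rcons v a) n Q) <= _)%E).
  elim: (enum letter) => [|a s IHs]; first by rewrite !big_nil measure0.
  rewrite !big_cons; apply: le_trans (measureU2 _ _ _) _.
  - by have [] := IH (rcons v a).
  - by apply: bigsetU_measurable => b _; have [] := IH (rcons v b).
  - exact: leeD.
rewrite /= mulr_sumr -sumEFin -big_enum /=; apply: lee_sum => a _.
have [_ h] := IH (rcons v a); apply: le_trans h _.
rewrite lee_fin -cats1 big_cat big_seq1 /= mulrA.
by under eq_mean do rewrite -catA.
Qed.

Lemma prefix_bound n (Q : pred (seq letter)) :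
  measurable [set w : Omega m | Q (pfx (w : nat -> letter) n)] /\
  (P [set w : Omega m | Q (pfx (w : nat -> letter) n)] <= (mean n (fun u => (Q u)%:R))%:E)%E.
Proof.
have := wordset_bound [::] n Q; rewrite big_nil mul1r.
suff -> : wordset [::] n Q = [set w : Omega m | Q (pfx (w : nat -> letter) n)] by [].
by apply/seteqP; split=> w; [case|split].
Qed.

(** Chernoff's bound decays geometrically in the number of blocks, and the
Borel-Cantelli lemma applies. *)
Lemma subadditive_ae_le (f : seq letter -> R) k (b e : R) :
  (forall u v, f (u ++ v) <= f u + f v) -> 0 < b ->
  (forall u, size u = k -> `|f u| <= b) -> 0 < e ->
  {ae P, forall w : Omega m, \forall q \near \oo,
    f (pfx (w : nat -> letter) (q * k)) <= q%:R * (mean k f + e)}.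
Proof.
move=> f_sub b0 fb e0.
pose F q := [set w : Omega m | q%:R * (mean k f + e) < f (pfx (w : nat -> letter) (q * k))].
(* The first bound on s allows the quadratic estimate of exp, the second makes
   the exponent 2 (s b)^2 - s e at most - s e / 2. *)
pose s := Num.min (1 / (2 * b)) (e / (4 * b ^+ 2)).
have s0 : 0 < s by rewrite lt_min !divr_gt0 // mulr_gt0 // exprn_gt0.
have sb : s * b <= 1 / 2.
  have : s <= 1 / (2 * b) by rewrite ge_min lexx.
  by rewrite ler_pdivlMr ?mulr_gt0 // => h; nra.
have se : 4 * (s * b ^+ 2) <= e.
  have : s <= e / (4 * b ^+ 2) by rewrite ge_min lexx orbT.
  by rewrite ler_pdivlMr ?mulr_gt0 ?exprn_gt0 // mulrCA.
pose c := expR (s * f [::]).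
pose rho := expR (2 * (s * b) ^+ 2 - s * e).
have rho1 : rho < 1.
  rewrite expR_lt1 subr_lt0 exprMn.
  apply: le_lt_trans (_ : s * (e / 2) < _); last by rewrite ltr_pM2l //; lra.
  by rewrite expr2 -!mulrA mulrCA ler_pM2l //; lra.
have rho0 : 0 <= rho by exact: expR_ge0.
have PF q : measurable (F q) /\ (P (F q) <= (c * rho ^+ q)%:E)%E.
  have [mF hF] := prefix_bound (q * k) (fun u => q%:R * (mean k f + e) < f u).
  split => //; apply: le_trans hF _; rewrite lee_fin.
  exact: (chernoff f_sub q e b0 (ltW s0) sb fb).
have lim0 : P (lim_sup_set F) = 0%E.
  apply: lim_sup_set_cvg0 => [q|]; first by have [] := PF q.
  apply: le_lt_trans (ltry (c / (1 - rho))); apply: lime_le.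
    by apply: is_cvg_nneseries => q _ _; exact: measure_ge0.
  apply: nearW => n.
  apply: le_trans (_ : (\sum_(0 <= q < n) (c * rho ^+ q)%:E <= _)%E).
    by apply: lee_sum => q _; have [] := PF q.
  rewrite sumEFin lee_fin -mulr_sumr ler_wpM2l ?expR_ge0 //.
  rewrite -[leRHS]mul1r ler_pdivlMr ?subr_gt0 // big_mkord -opprB mulrN mulrC -subrX1.
  by rewrite opprB gerBl exprn_ge0.
exists (lim_sup_set F); split => //.
  apply: bigcapT_measurable => n; apply: bigcup_measurable => q _.
  by have [] := PF q.
move=> w /= nw n _; apply: contrapT => no; apply: nw.
exists n => // q /= nq; rewrite leNgt; apply/negP => lt; apply: no.
by exists q.
Qed.

(** Both [f] and [C - f] are subadditive. Their growth over blocks of length [k]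
confines the quotient, for large [n], to an interval of length O(1/k), so it is a
Cauchy sequence. *)
Lemma almost_additive_ae_cvg (f : seq letter -> R) (C : R) :
  (forall u, 0 <= f u) -> (forall u v, f u <= f (u ++ v)) ->
  (forall u v, f (u ++ v) <= f u + f v) ->
  (forall u v, f u + f v <= f (u ++ v) + C) ->
  {ae P, forall w : Omega m, cvg (f (pfx (w : nat -> letter) n) / n%:R @[n --> \oo])}.
Proof.
move=> f0 fmono fsub fsup.
have C0 : 0 <= C by have := fsup [::] [::]; have := f0 [::]; rewrite /=; lra.
pose B := \sum_a f [:: a].
have fB u : f u <= (size u)%:R * B + f [::].
  elim: u => [|a u IH]; first by rewrite mul0r add0r.
  rewrite -cat1s; apply: le_trans (fsub _ _) _.
  rewrite /= -natr1 mulrDl mul1r addrAC [leRHS]addrC; apply: lerD IH.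
  by rewrite /B (bigD1 a) //= lerDl sumr_ge0.
pose b k := C + (k%:R * B + f [::]) + 1.
have kB0 k : 0 <= k%:R * B + f [::] by rewrite addr_ge0 // mulr_ge0 // sumr_ge0.
have b0 k : 0 < b k by rewrite /b; have := kB0 k; lra.
have fb k u : size u = k -> `|f u| <= b k.
  by move=> su; rewrite ger0_norm // /b; have := fB u; rewrite su; lra.
have gb k u : size u = k -> `|C - f u| <= b k.
  move=> su; rewrite /b ler_norml; have := fB u; have := f0 u; rewrite su => h1 h2.
  by apply/andP; split; lra.
have gsub u v : C - f (u ++ v) <= (C - f u) + (C - f v) by have := fsup u v; lra.
have meang k : mean k (fun u => C - f u) = C - mean k f.
  rewrite (@eq_mean _ _ (fun u => C + (-1) * f u)) => [|u _]; last by rewrite mulN1r.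
  by rewrite meanD meanZ mean_cst mulN1r.
have le_f := ae_foralln (fun k => subadditive_ae_le fsub (b0 k) (@fb k) ltr01).
have ge_f := ae_foralln (fun k => subadditive_ae_le gsub (b0 k) (@gb k) ltr01).
apply: filterS2 le_f ge_f => w /= le_f ge_f.
set F := fun n => f (pfx (w : nat -> letter) n).
have Fmono n j : F n <= F (n + j)%N by rewrite /F pfxD.
apply: cauchy_cvg; apply: cauchy_exP => eta eta0.
have [k kgt0 kC] : exists2 k, (0 < k)%N & (C + 2) < k%:R * (eta / 2).
  exists (Num.truncn (2 * (C + 2) / eta)).+1 => //.
  have h : 0 <= 2 * (C + 2) / eta by rewrite divr_ge0 ?(ltW eta0) //; lra.
  have /andP[_] := truncn_itv h.
  by rewrite ltr_pdivrMr //; lra.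
have k0 : 0 < k%:R :> R by rewrite ltr0n.
have [q1 _ le_q] := le_f k; have [q2 _ ge_q] := ge_f k; rewrite /= in le_q ge_q.
pose Y := mean k f + 1.
have Y0 : 0 <= Y.
  have : 0 <= mean k f by rewrite -(mean_cst k 0); apply: mean_le.
  by rewrite /Y; lra.
exists (Y / k%:R).
exists (maxn (maxn q1 q2 * k) (Num.truncn (2 * Y / eta)).+1) => // n /=.
rewrite geq_max => /andP[nq nY].
have q12 : (maxn q1 q2 <= n %/ k)%N by rewrite leq_divRL.
move: q12; rewrite geq_max => /andP[q1n q2n].
have n0 : 0 < n%:R :> R by rewrite ltr0n (leq_trans _ nY).
have nY2 : Y < n%:R * (eta / 2).
  have : 2 * Y / eta < n%:R.
    have h : 0 <= 2 * Y / eta by rewrite divr_ge0 ?(ltW eta0) // mulr_ge0.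
    have /andP[_ h2] := truncn_itv h; apply: lt_le_trans h2 _.
    by rewrite ler_nat.
  by rewrite ltr_pdivrMr //; lra.
(* By monotonicity, round n down or up to a multiple of k. *)
have ub : F n <= (n %/ k).+1%:R * Y.
  apply: le_trans (le_q _ (leqW q1n)).
  have nk : (n <= (n %/ k).+1 * k)%N by apply: ltnW; exact: ltn_ceil.
  by rewrite -(subnKC nk); exact: Fmono.
have lb : (n %/ k)%:R * (Y - (C + 2)) <= F n.
  apply: le_trans (_ : F (n %/ k * k)%N <= _); last first.
    by rewrite -{2}(subnKC (leq_divM n k)); exact: Fmono.
  have := ge_q _ q2n; rewrite meang -/(F _) /Y mulrDr mulr1; lra.
pose t : R := n%:R / k%:R.
have qt : (n %/ k)%:R <= t by rewrite ler_pdivlMr // -natrM ler_nat leq_divM.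
have tq : t <= (n %/ k)%:R + 1.
  by rewrite ler_pdivrMr // natr1 -natrM ler_nat ltnW // ltn_ceil.
have tC : t * (C + 2) < n%:R * (eta / 2).
  by rewrite mulrAC ltr_pdivrMr // -mulrA ltr_pM2l // mulrC.
have tY : Y / k%:R = t * Y / n%:R.
  by rewrite /t; field; rewrite !lt0r_neq0.
rewrite /ball /= tY -mulrBl normrM [X in _ * X]ger0_norm ?invr_ge0 ?(ltW n0) //.
rewrite ltr_pdivrMr // ltr_norml -/(F n); rewrite -natr1 in ub.
have q0 : 0 <= (n %/ k)%:R :> R by [].
have {}nY2 : 2 * Y < n%:R * eta by lra.
have {}tC : 2 * (t * (C + 2)) < n%:R * eta by lra.
clearbody t Y; move: (n %/ k)%:R (F n) t qt tq tC ub lb q0 nY2 {tY}.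
move=> q Fn t' qt tq tC ub lb q0 nY2.
have h1 : q * Y <= t' * Y by rewrite ler_wpM2r.
have h2 : (t' - 1) * Y <= q * Y by rewrite ler_wpM2r //; lra.
have h3 : q * (C + 2) <= t' * (C + 2) by rewrite ler_wpM2r //; lra.
rewrite mulrBr in lb; rewrite mulrDl mul1r in ub; rewrite mulrBl mul1r in h2;
  by rewrite [eta * _]mulrC; apply/andP; split; lra.
Qed.

End Bernoulli.

(** * Almost sure growth rate and the dimension formula *)

Lemma log_npts_ae_cvg (R : realType) (m : nat) (theta : 'I_m.+1 -> R)
    (theta_gt0 : forall j, 0 < theta j) (theta_sum1 : \sum_j theta j = 1)
    (P : probability (Omega m) R) (P_bernoulli : is_bernoulli theta P)
    (S : rifs R m)
    (hull : forall w : nat -> 'I_m.+1, conv_hull (attractor S w) = [set` `[0, 1]])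
    (c : R) (c_gt0 : 0 < c)
    (sep : forall u x y, x \in pts S u -> y \in pts S u -> x != y ->
      c * rifs_ratio S ^+ size u <= `|x - y|) :
  {ae P, forall w : Omega m,
    cvg ((ln (npts S (pfx (w : nat -> 'I_m.+1) n))%:R / n%:R : R) @[n --> \oo])}.
Proof.
have M0 u : 0 < (npts S u)%:R :> R by rewrite ltr0n npts_gt0.
apply: (almost_additive_ae_cvg theta_gt0 theta_sum1 P_bernoulli
  (f := fun u => ln (npts S u)%:R) (C := ln (mult c 1)%:R)).
- by move=> u; rewrite ln_ge0 // ler1n npts_gt0.
- by move=> u v; rewrite ler_ln ?posrE // ler_nat npts_le_cat.
- move=> u v; rewrite -lnM ?posrE // -natrM ler_ln ?posrE ?ler_nat ?npts_cat_le //.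
  by rewrite natrM mulr_gt0.
- move=> u v; rewrite -!lnM ?posrE // -!natrM ler_ln ?posrE ?natrM ?mulr_gt0 //.
  by rewrite -!natrM ler_nat mulnC [leqRHS]mulnC [(npts S v * _)%N]mulnC; exact: npts_cat_ge.
Qed.

Theorem proposition4p20 (R : realType) (m : nat)
    (theta : 'I_m.+1 -> R)
    (theta_gt0 : forall j, 0 < theta j)
    (theta_sum1 : \sum_j theta j = 1)
    (P : probability (Omega m) R)
    (P_bernoulli : is_bernoulli theta P)
    (S : rifs R m)
    (S_hull : forall w : nat -> 'I_m.+1,
       conv_hull (attractor S w) = [set` `[0, 1]])
    (S_finite_type : finite_type S)
    (N : nat) (gamma : 'I_N -> charvec R)
    (gamma_inj : injective gamma)
    (gamma_essential : essential_class S (range gamma)) :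
  {ae P, forall w : Omega m, exists L : R,
    [/\ ln (mx_sum_norm (\big[mulmx/1%:M]_(i < n) adjacency S gamma (w i)))
          / (n%:R * `|ln (rifs_ratio S)|) @[n --> \oo] --> L,
        has_box_dimension (attractor S w) L
      & hausdorff_dimension (attractor S w) = L%:E]}.
Proof.
have [c /andP[c_gt0 _] sep] := finite_type_separated S_finite_type.
have [[[_ [i0 _ _]] gamma_cv _] gamma_closed] := gamma_essential.
have [C1 C1_gt0 norm_le] := norm_le_npts S_hull gamma_inj gamma_cv.
have [C2 C2_gt0 norm_ge] : exists2 C : R, 0 < C & forall w k,
    (npts S (pfx w k))%:R <= C * mx_sum_norm (mprod S gamma (pfx w k)).
  have [w0 [n0 [D0 [D0n D0i]]]] := gamma_cv _ (ex_intro2 _ _ i0 I erefl).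
  apply: (npts_le_norm S_hull _ D0n (esym D0i)) => i b ib.
  by have [j _ jb] := gamma_closed _ _ (ex_intro2 _ _ i I erefl) ib; exists j.
set l := - ln (rifs_ratio S).
have l_gt0 : 0 < l by rewrite oppr_gt0 ln_lt0 // ratio_gt0 ratio_lt1.
have -> : `|ln (rifs_ratio S)| = l.
  by rewrite -normrN ger0_norm // ltW.
apply: filterS (log_npts_ae_cvg theta_gt0 theta_sum1 P_bernoulli S_hull c_gt0 sep).
move=> w /=; set g := (X in cvg (X @ _)) => /cvg_ex[lambda g_lambda].
have M0 u : 0 < (npts S u)%:R :> R by rewrite ltr0n npts_gt0.
have x_L : ln (npts S (pfx (w : nat -> 'I_m.+1) n))%:R / (n%:R * l) @[n --> \oo] --> lambda / l.
  rewrite (_ : (fun n => _) = fun n => g n / l); last first.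
    by apply/funext => n; rewrite /g invfM mulrA.
  by apply: cvgM => //; exact: cvg_cst.
exists (lambda / l); split.
- have inv0 : (n%:R^-1 : R) @[n --> \oo] --> (0 : R).
    by rewrite -(cvg_shiftS (fun n => n%:R^-1 : R)); exact: cvg_harmonic.
  have shifted (b : R) : ln (npts S (pfx (w : nat -> 'I_m.+1) n))%:R / (n%:R * l)
      + b / l * n%:R^-1 @[n --> \oo] --> lambda / l.
    rewrite -[X in _ --> X](_ : lambda / l + b / l * 0 = _); last by rewrite mulr0 addr0.
    by apply: cvgD => //; apply: cvgM => //; exact: cvg_cst.
  apply: (squeeze_cvgr _ (shifted (- ln C2)) (shifted (ln C1))).
  near=> n.
  have n0 : 0 < n%:R :> R by rewrite ltr0n; near: n; exists 1%N.
  rewrite mprod_pfx; set a := mx_sum_norm _.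
  have ge := norm_ge w n; have le := norm_le (pfx (w : nat -> 'I_m.+1) n).
  have a0 : 0 < a by rewrite -(pmulr_rgt0 _ C2_gt0); exact: lt_le_trans ge.
  have nl : 0 < n%:R * l by rewrite mulr_gt0.
  have split_frac b : ln (npts S (pfx (w : nat -> 'I_m.+1) n))%:R / (n%:R * l) + b / l / n%:R =
      (ln (npts S (pfx (w : nat -> 'I_m.+1) n))%:R + b) / (n%:R * l).
    by field; rewrite !lt0r_neq0.
  rewrite !split_frac !ler_pM2r ?invr_gt0 // lerBlDl addrC -!lnM ?posrE //.
  by rewrite !ler_ln ?posrE ?mulr_gt0 // mulrC ge mulrC.
- exact: (box_dimension S_hull c_gt0 sep x_L).
- exact: (hausdorff_dimension_attractor S_hull c_gt0 sep x_L).
Unshelve. all: by end_near.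
Qed.
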